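(* A connected (possibly infinite) graph $G$ admits a tree-decomposition into finite cliques (a tree-decomposition all of whose parts induce finite complete subgraphs of $G$) if and only if $G$ is chordal, $G$ admits a normal spanning tree, and $G$ does not contain $\mathcal H$ as an induced minor.
   Context: A graph is chordal if it has no induced cycle of length at least four. A normal spanning tree of a connected graph $G$ is a rooted spanning tree $T$ such that the endpoints of every edge of $G$ are comparable in the tree-order of $T$. $\mathcal H$ denotes the graph obtained from a (countably) infinite clique by adding two non-adjacent vertices each adjacent to all vertices of the clique. A minor embedding of $H$ into $G$ is a family $\{B_v : v\in V(H)\}$ of disjoint connected subgraphs of $G$ (branch sets) such that there is a $B_u$–$B_v$ edge in $G$ whenever $uv\in E(H)$; it is an induced minor embedding if there is a $B_u$–$B_v$ edge in $G$ precisely when $uv\in E(H)$ (for $u\neq v$). $H$ is an induced minor of $G$ if such an induced minor embedding exists. Tree-decompositions are in the usual (Diestel) sense. *)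

(* Defs.v *)
From mathcomp Require Import all_boot.
From mathcomp Require Import boolp classical_sets cardinality.

Set Implicit Arguments.
Unset Strict Implicit.
Unset Printing Implicit Defensive.

Local Open Scope classical_set_scope.

Record graph := Graph {
  vertex :> Type;
  adj : vertex -> vertex -> Prop;
  adj_sym : forall x y, adj x y -> adj y x;
  adj_irrefl : forall x, ~ adj x x }.

(* Boolean adjacency on {classic G}, which carries the eqType structure that
   path, uniq and next require. *)
Definition adjb (G : graph) : rel {classic G} := fun x y => `[< @adj G x y >].

(* The walk or path with starting vertex x and further vertices p. *)
Definition is_walk (G : graph) (x : {classic G}) (p : seq {classic G})
    (y : {classic G}) : Prop :=
  path (@adjb G) x p /\ last x p = y.

Definition is_path (G : graph) (x : {classic G}) (p : seq {classic G})
    (y : {classic G}) : Prop :=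
  is_walk x p y /\ uniq (x :: p).

(* The empty graph is not connected; in particular branch sets are nonempty. *)
Definition connected_graph (G : graph) : Prop :=
  inhabited G /\ forall x y : G, exists p, is_walk x p y.

(* ucycle alone also accepts [::] and the two ends of an edge. *)
Definition is_cycle (G : graph) (c : seq {classic G}) : Prop :=
  3 <= size c /\ ucycle (@adjb G) c.

Definition induced_cycle (G : graph) (c : seq {classic G}) : Prop :=
  is_cycle c /\
  forall x y : {classic G}, x \in c -> y \in c ->
    adj (x : G) y -> y = next c x \/ x = next c y.

Definition chordal (G : graph) : Prop :=
  ~ exists c : seq {classic G}, induced_cycle c /\ 4 <= size c.

Definition is_tree (T : graph) : Prop :=
  connected_graph T /\ ~ exists c : seq {classic T}, is_cycle c.

(* t lies on the path r T s, which is unique when T is a tree. *)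
Definition on_path (T : graph) (r s t : {classic T}) : Prop :=
  exists p, is_path r p s /\ t \in r :: p.

Definition tree_le (T : graph) (r s t : T) : Prop := on_path r t s.

Record subgraph (G : graph) := Subgraph {
  sub_vertex : set G;
  sub_adj : G -> G -> Prop;
  sub_adj_sym : forall x y, sub_adj x y -> sub_adj y x;
  sub_adj_vertex : forall x y, sub_adj x y -> sub_vertex x;
  sub_adj_adj : forall x y, sub_adj x y -> adj x y }.

Definition graph_of (G : graph) (S : subgraph G) : graph :=
  @Graph {x : G | sub_vertex S x}
    (fun x y => sub_adj S (sval x) (sval y))
    (fun x y => @sub_adj_sym G S (sval x) (sval y))
    (fun x xx => @adj_irrefl G (sval x) (sub_adj_adj xx)).

Definition normal_spanning_tree (G : graph) (T : subgraph G) (r : graph_of T) :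
    Prop :=
  [/\ sub_vertex T = setT,
      is_tree (graph_of T) &
      forall x y : graph_of T, adj (sval x) (sval y) ->
        tree_le r x y \/ tree_le r y x].

Definition has_normal_spanning_tree (G : graph) : Prop :=
  exists (T : subgraph G) (r : graph_of T), normal_spanning_tree r.

Definition induced_minor_embedding (H G : graph) (B : H -> subgraph G) : Prop :=
  [/\ forall v, connected_graph (graph_of (B v)),
      forall u v, u <> v -> sub_vertex (B u) `&` sub_vertex (B v) = set0 &
      forall u v, u <> v ->
        (adj u v <->
         exists x y, [/\ sub_vertex (B u) x, sub_vertex (B v) y & adj x y])].

Definition induced_minor (H G : graph) : Prop :=
  exists B : H -> subgraph G, induced_minor_embedding B.

(* The vertices inl n form the infinite clique, inr true and inr false are the
   two additional vertices. *)
Definition calH_adj (x y : nat + bool) : Prop :=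
  match x, y with
  | inl m, inl n => m <> n
  | inr _, inr _ => False
  | _, _ => True
  end.

Lemma calH_adj_sym x y : calH_adj x y -> calH_adj y x.
Proof. by case: x y => [m|b] [n|c] //= mn /esym. Qed.

Lemma calH_adj_irrefl x : ~ calH_adj x x.
Proof. by case: x => [m|b] /=. Qed.

Definition calH : graph := Graph calH_adj_sym calH_adj_irrefl.

Definition tree_decomposition (G T : graph) (V : T -> set G) : Prop :=
  [/\ is_tree T,
      forall x : G, exists t, V t x,
      forall x y : G, adj x y -> exists t, V t x /\ V t y &
      forall t1 t2 t3 : T, on_path t1 t3 t2 -> V t1 `&` V t3 `<=` V t2].

Definition clique (G : graph) (A : set G) : Prop :=
  forall x y, A x -> A y -> x <> y -> adj x y.

Definition has_tree_decomposition_into_finite_cliques (G : graph) : Prop :=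
  exists (T : graph) (V : T -> set G),
    tree_decomposition V /\ forall t, finite_set (V t) /\ clique (V t).

(* Main.v *)
(* The pivot is the notion of an elimination function: a map h from the vertices
   to nat that takes different values on adjacent vertices and for which the
   neighbours of x of smaller value always form a clique. Hanging every vertex
   below its highest lower neighbour yields a normal spanning tree T, and the sets
   consisting of x and its lower neighbours form a tree-decomposition over T into
   finite cliques. Conversely, in a tree-decomposition into finite cliques one
   orders the vertices by the height of the topmost part containing them, breaking
   ties inside that part. A vertex of maximal h on a cycle has adjacent neighbours,
   whence chordality; and if two non-adjacent connected sets A, B have tops a, b
   with h b <= h a, then every connected set touching both contains one of the
   finitely many lower neighbours of a, so calH is not an induced minor.

   For the converse, chordality makes the vertices adjacent to both of two
   disjoint non-adjacent connected sets a clique, and the absence of calH makes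
   this clique finite. This implies that a vertex x of a component C attached to a
   finite clique can be reached in finitely many steps, each adding a vertex whose
   earlier neighbours form a clique, such that all the remaining components of C
   are attached to finite cliques again. Reaching simultaneously the tree-minimal
   vertex of every component, and iterating, exhausts the graph after omega
   rounds, since the tree-heights of the minimal vertices increase. *)
Require Import Defs.
From mathcomp Require Import all_boot zify.
From mathcomp Require Import boolp classical_sets functions cardinality.

Set Implicit Arguments.
Unset Strict Implicit.
Unset Printing Implicit Defensive.

Local Open Scope classical_set_scope.

(** * Connected sets *)

Section Connectivity.
Variable G : graph.
Implicit Types (x y z : G) (C D E : set G).

Inductive conn D x : G -> Prop :=
| conn_refl : D x -> conn D x x
| conn_step y z : conn D x y -> adj y z -> D z -> conn D x z.

(** The empty set counts as connected here, unlike in [connected_graph]; nonemptiness is asked for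
    separately. *)
Definition connected D := forall x y, D x -> D y -> conn D x y.

Definition nb D : set G := [set y | exists2 z, D z & adj y z].

Definition component D x : set G := conn D x.

Lemma adj_neq x y : adj x y -> x <> y.
Proof. by move=> xy exy; apply: (@adj_irrefl G x); rewrite {2}exy. Qed.

Lemma conn_tgt D x y : conn D x y -> D y.
Proof. by elim. Qed.

Lemma conn_last D x y : conn D x y -> x <> y -> exists2 z, conn D x z & adj z y.
Proof. by case=> // z t xz zt _ _; exists z. Qed.

Lemma conn_trans D y x z : conn D x y -> conn D y z -> conn D x z.
Proof. by move=> xy; elim=> // u v _ xu uv Dv; apply: conn_step uv Dv. Qed.

Lemma conn_adj D x y : D x -> D y -> adj x y -> conn D x y.
Proof. by move=> Dx Dy xy; apply: conn_step xy Dy; apply: conn_refl. Qed.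

Lemma conn_sym D x y : conn D x y -> conn D y x.
Proof.
elim=> [|u v xu IH uv Dv]; first exact: conn_refl.
apply: conn_trans IH; apply: conn_adj => //; first exact: conn_tgt xu.
exact: adj_sym.
Qed.

Lemma conn_sub D E x y : D `<=` E -> conn D x y -> conn E x y.
Proof.
move=> DE; elim=> [Dx|u v _ IH uv Dv]; first by apply: conn_refl; apply: DE.
by apply: conn_step IH uv _; apply: DE.
Qed.

Lemma connected_from D x : (forall y, D y -> conn D x y) -> connected D.
Proof.
by move=> xD y z Dy Dz; apply: conn_trans (xD _ Dz); apply/conn_sym/xD.
Qed.

Lemma connectedU D E x y :
  connected D -> connected E -> D x -> E y -> (x = y \/ adj x y) ->
  connected (D `|` E).
Proof.
move=> cD cE Dx Ey xy; apply: (@connected_from _ x) => z [Dz|Ez].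
  by apply: conn_sub (cD _ _ Dx Dz) => ? ?; left.
have yz : conn (D `|` E) y z by apply: conn_sub (cE _ _ Ey Ez) => ? ?; right.
case: xy => [->//|xy]; apply: conn_trans yz.
by apply: conn_adj => //; [left|right].
Qed.

Lemma component_refl D x : D x -> component D x x.
Proof. exact: conn_refl. Qed.

Lemma component_sub D x : component D x `<=` D.
Proof. by move=> y; apply: conn_tgt. Qed.

Lemma component_conn D x y z : component D x y -> conn D y z -> conn (component D x) y z.
Proof.
move=> xy; elim=> [_|u v yu IH uv Dv]; first exact: conn_refl.
by apply: (conn_step IH uv); apply: conn_trans xy (conn_step yu uv Dv).
Qed.

Lemma component_connected D x : connected (component D x).
Proof.
move=> y z xy xz; apply: component_conn => //; apply: conn_trans xz.
exact: conn_sym.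
Qed.

Lemma component_nb D x y : D y -> nb (component D x) y -> component D x y.
Proof. by move=> Dy [z xz yz]; apply: conn_step xz (adj_sym yz) Dy. Qed.

Lemma component_max D x E : connected E -> E x -> E `<=` D -> E `<=` component D x.
Proof. by move=> cE Ex ED y Ey; apply: conn_sub ED (cE _ _ Ex Ey). Qed.

Lemma component_eq D x y : component D x y -> component D y = component D x.
Proof.
move=> xy; apply/seteqP; split=> z; first exact: conn_trans.
by move=> xz; apply: conn_trans xz; apply: conn_sym.
Qed.

(** A walk inside [D] that leaves [C] would do so at a neighbour of [C]. *)
Lemma connected_trap C D x :
  connected D -> D x -> C x -> (forall y, D y -> nb C y -> C y) -> D `<=` C.
Proof.
move=> cD Dx Cx DC y Dy; elim: (cD _ _ Dx Dy) => // u v _ Cu uv Dv.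
by apply: DC => //; exists u => //; apply: adj_sym.
Qed.

Lemma nb_sub C D : C `<=` D -> nb C `<=` nb D.
Proof. by move=> CD y [z Cz yz]; exists z => //; apply: CD. Qed.

Lemma nb1 x y : nb [set x] y <-> adj y x.
Proof. by split=> [[_ ->]|xy] //; exists x. Qed.

Lemma clique_sub C D : C `<=` D -> clique D -> clique C.
Proof. by move=> CD cD x y Cx Cy; apply: cD; apply: CD. Qed.

Lemma connected1 x : connected [set x].
Proof. by move=> _ _ -> ->; apply: conn_refl. Qed.

End Connectivity.

Section Walks.
Variable G : graph.
Implicit Types (x y z : {classic G}) (p q : seq {classic G}) (D : set G).

Lemma adjbP x y : reflect (@adj G x y) (adjb x y).
Proof. exact: asboolP. Qed.

Lemma walk_conn D x p :
  path (@adjb G) x p -> (forall z, z \in x :: p -> D z) -> conn D x (last x p).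
Proof.
elim/last_ind: p => [_ Dp|p y IH]; first by apply: conn_refl; apply: Dp; rewrite inE.
rewrite rcons_path last_rcons => /andP[xp /adjbP py] Dp.
apply: (conn_step _ py); last by apply: Dp; rewrite inE mem_rcons inE eqxx orbT.
by apply: IH => // z zp; apply: Dp; rewrite -rcons_cons mem_rcons inE zp orbT.
Qed.

Lemma walk_connected x p :
  path (@adjb G) x p -> connected [set z : G | (z : {classic G}) \in x :: p].
Proof.
move=> xp; apply: (@connected_from _ _ x) => v vp.
have {vp} : (v : {classic G}) \in x :: p := vp.
rewrite in_cons => /orP[/eqP->|vp]; first by apply: conn_refl; exact: mem_head.
case/splitPr: vp xp => p1 p2; rewrite cat_path => /andP[xp1 /andP[p1v _]].
rewrite -[X in conn _ _ X](last_rcons x p1 v); apply: walk_conn.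
  by rewrite rcons_path xp1.
move=> z zp; change (z \in x :: p1 ++ v :: p2).
  move: zp; rewrite !in_cons mem_rcons mem_cat !in_cons.
by move=> /or3P[]->; rewrite ?orbT.
Qed.

Lemma conn_path D x y :
  conn D x y -> exists2 p, is_path x p y & forall z, z \in x :: p -> D z.
Proof.
move=> xy.
have [p [xp py] pD] : exists2 p, is_walk x p y & forall z, z \in x :: p -> D z.
  elim: xy => [Dx|u v _ [p [xp pu] pD] uv Dv].
    by exists [::] => // z; rewrite inE => /eqP->.
  exists (rcons p v); first by split; rewrite ?last_rcons // rcons_path xp pu; apply/adjbP.
  by move=> z; rewrite -rcons_cons mem_rcons inE => /orP[/eqP->|/pD].
case: (shortenP xp) py => q xq uq qp py.
exists q => // z; rewrite inE => /orP[/eqP->|zq]; apply: pD; rewrite inE ?eqxx //.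
by rewrite (qp _ zq) orbT.
Qed.

Lemma connected_graphP :
  connected_graph G <-> inhabited G /\ connected [set: G].
Proof.
split=> -[iG cG]; split=> // x y.
  by move=> _ _; have [p [xp <-]] := cG x y; apply: walk_conn.
by have [p [xp _] _] := conn_path (cG x y I I); exists p.
Qed.

(* The two neighbours [u], [w] of [t] are joined by a path avoiding [t], which
   closes up through [t]. *)
Lemma conn_cycle (t u w : {classic G}) :
  adj (t : G) u -> adj (t : G) w -> u <> w -> conn [set~ (t : G)] u w ->
  exists c : seq {classic G}, is_cycle c.
Proof.
move=> tu tw uw /conn_path[p [[up pw] uq] pt].
exists (t :: u :: p); split.
  by case: p pw {up uq pt} => [/= /uw|].
rewrite /ucycle /= rcons_path up pw /= -/(uniq (u :: p)) uq andbT.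
apply/andP; split; last by apply/negP => /pt; apply.
by apply/andP; split; apply/adjbP => //; apply: adj_sym.
Qed.

End Walks.

(** * Elimination functions *)

Lemma next_consec (T : eqType) (w1 w2 : seq T) x y :
  uniq (w1 ++ x :: y :: w2) -> next (w1 ++ x :: y :: w2) x = y.
Proof. by move=> u; rewrite -(next_rot (size w1)) // rot_size_cat /= eqxx. Qed.

Lemma next_last (T : eqType) (w : seq T) x y :
  uniq (y :: rcons w x) -> next (y :: rcons w x) x = y.
Proof.
move=> u; rewrite -(next_rot (size (y :: w))) // -rcons_cons -cats1 rot_size_cat.
by rewrite /= eqxx.
Qed.

Lemma seq_argmax (T : eqType) (h : T -> nat) (c : seq T) :
  c != [::] -> exists2 x, x \in c & forall y, y \in c -> h y <= h x.
Proof.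
elim: c => // x [_ _|y c /(_ isT)[z zc zmax] _].
  by exists x => [|y]; rewrite inE // => /eqP->.
have [hzx|/ltnW hxz] := leqP (h z) (h x).
  exists x => [|t]; rewrite inE ?eqxx // => /orP[/eqP->//|/zmax].
  by move=> /leq_trans; apply.
by exists z => [|t]; rewrite inE ?zc ?orbT // => /orP[/eqP->//|/zmax].
Qed.

Lemma nat_inj_unbounded (f : nat -> nat) n : injective f -> exists i, n <= f i.
Proof.
move=> injf; apply: contrapT => /forallNP fn.
suff : size (map f (iota 0 n.+1)) <= size (iota 0 n).
  by rewrite size_map !size_iota ltnn.
apply: uniq_leq_size; first by rewrite map_inj_uniq // iota_uniq.
move=> _ /mapP[i _ ->]; rewrite mem_iota /= add0n ltnNge.
by apply/negP; apply: fn.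
Qed.

Lemma finite_set_bounded_inj (T : Type) (A : set T) (h : T -> nat) n :
  (forall x y, A x -> A y -> h x = h y -> x = y) ->
  (forall x, A x -> h x < n) -> finite_set A.
Proof.
elim: n A => [|n IH] A injh hn.
  suff -> : A = set0 by exact: finite_set0.
  by apply/seteqP; split=> // x /hn.
apply: (@sub_finite_set _ _ ((A `&` [set x | h x < n]) `|` (A `&` [set x | h x = n]))).
  move=> x Ax; have := hn _ Ax; rewrite ltnS leq_eqVlt => /orP[/eqP xn|xn].
    by right.
  by left.
rewrite finite_setU; split.
  by apply: IH => [x y [Ax _] [Ay _]|x []//]; apply: injh.
have [[x [Ax xn]]|N] := pselect (exists x, A x /\ h x = n).
  apply: (@sub_finite_set _ _ [set x]); last exact: finite_set1.
  by move=> y [Ay yn]; apply: injh; rewrite // xn yn.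
suff -> : A `&` [set x | h x = n] = set0 by exact: finite_set0.
by apply/seteqP; split=> // x xA; apply: N; exists x.
Qed.

Section Elimination.
Variable G : graph.
Implicit Types (x y z : G) (C D Q : set G) (h : G -> nat).

Definition lower h x : set G := [set y | adj x y /\ h y < h x].

Definition elimination h :=
  (forall x y, adj x y -> h x <> h y) /\ forall x, clique (lower h x).

Lemma lower_or h x y : elimination h -> adj x y -> lower h x y \/ lower h y x.
Proof.
move=> [hP _] xy; have := hP _ _ xy.
case: (ltngtP (h x) (h y)) => // ? _; [right|left]; split=> //.
exact: adj_sym.
Qed.

Lemma lower_inj h x y z :
  elimination h -> lower h x y -> lower h x z -> h y = h z -> y = z.
Proof.
move=> [hP hC] xy xz yz; apply: contrapT => nyz.
by apply: hP yz; apply: hC xy xz nyz.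
Qed.

(** [h] is injective on the clique of lower neighbours and bounded there by [h x]. *)
Lemma lower_finite h x : elimination h -> finite_set (lower h x).
Proof.
move=> hE; apply: (@finite_set_bounded_inj _ _ h (h x)); last by move=> y [].
by move=> y z; apply: lower_inj.
Qed.

(* The vertices of value [n.+1] are pairwise non-adjacent, and a walk through
   one of them can be short-cut in the clique of its lower neighbours. *)
Lemma conn_level h Q n x y : elimination h ->
  h x <= n -> h y <= n -> conn (Q `&` [set z | h z <= n.+1]) x y ->
  conn (Q `&` [set z | h z <= n]) x y.
Proof.
move=> hE hx hy xy; set Qn := _ `&` _.
(* The second conjunct is for a walk currently at value [n.+1]: whichever vertex [z] it moves to
   next is reached within [Qn]. *)
suff : (h y <= n -> conn Qn x y) /\
  (h y = n.+1 -> forall z, Q z -> adj y z -> h z <= n -> conn Qn x z).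
  by case=> /(_ hy).
elim: xy {hy} => [[Qx _]|u v xu [IH1 IH2] uv [Qv /= hv]].
  split=> [_|e]; first by apply: conn_refl.
  by move: hx; rewrite e ltnn.
have [_ /= hu] := conn_tgt xu.
split=> hv'.
  move: hu; rewrite leq_eqVlt => /orP[/eqP hu|hu]; first exact: IH2.
  exact: conn_step (IH1 hu) uv _.
move: hu; rewrite leq_eqVlt => /orP[/eqP hu|hu].
  by case: (hE.1 _ _ uv); rewrite hu hv'.
move=> z Qz vz hz; have [<-|uz] := pselect (u = z); first exact: IH1.
apply: (conn_step (IH1 hu)) => //.
by apply: (hE.2 v) => //; split; rewrite ?hv' //; apply: adj_sym.
Qed.

(** A walk is finite, so its values have some bound [n + m]; [conn_level] lowers this bound by one
    at a time. *)
Lemma conn_below h Q n x y : elimination h -> connected Q -> Q x -> Q y ->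
  h x <= n -> h y <= n -> conn (Q `&` [set z | h z <= n]) x y.
Proof.
move=> hE cQ Qx Qy hx hy.
have [m xy] : exists m, conn (Q `&` [set z | h z <= n + m]) x y.
  elim: (cQ _ _ Qx Qy) => [_|u v _ [m xu] uv Qv].
    by exists 0; apply: conn_refl; split=> //=; lia.
  exists (m + h v); apply: (conn_step _ uv); last by split=> //=; lia.
  by apply: conn_sub xu => z [Qz /= ?]; split=> //=; lia.
elim: m xy => [|m IH]; first by rewrite addn0.
by rewrite addnS => xy; apply: IH; apply: conn_level => //; lia.
Qed.

(** By [conn_below] some walk in [Q] from [y] to [x] has values at most [h x]; its vertex just
    before [x] is the required one. *)
Lemma connected_lower h Q x y : elimination h -> connected Q -> Q x -> Q y ->
  x <> y -> h y <= h x -> exists2 z, Q z & lower h x z.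
Proof.
move=> hE cQ Qx Qy xy hyx; have := conn_below hE cQ Qy Qx hyx (leqnn _).
move=> /conn_last[|u yu ux]; first by move=> /esym.
have [Qu /= hu] := conn_tgt yu; exists u => //; split; first exact: adj_sym.
by have := hE.1 _ _ ux; lia.
Qed.

Lemma set_argmin h D : D !=set0 -> exists2 x, D x & forall y, D y -> h x <= h y.
Proof.
move=> [x0 Dx0]; have ex : exists n, `[< exists2 x, D x & h x = n >].
  by exists (h x0); apply/asboolP; exists x0.
case: (ex_minnP ex) => n /asboolP[x Dx xn] nmin; exists x => // y Dy.
by rewrite xn; apply: nmin; apply/asboolP; exists y.
Qed.

Lemma connected_argmin_uniq h Q x y : elimination h -> connected Q -> Q x -> Q y ->
  (forall z, Q z -> h x <= h z) -> h y <= h x -> x = y.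
Proof.
move=> hE cQ Qx Qy xmin yx; apply: contrapT => xy.
have [z Qz [_ /=]] := connected_lower hE cQ Qx Qy xy yx.
by rewrite ltnNge xmin.
Qed.

(** [x] maximises [h] on the cycle and [y], [z] are its neighbours there. This gives chordality,
    where [y] and [z] are shown to be adjacent, and acyclicity of rooted trees, where both would be
    the parent of [x]. *)
Lemma cycle_top h (c : seq {classic G}) : is_cycle c ->
  exists x y z : {classic G},
    [/\ adj (x : G) y, adj (x : G) z, y <> z, h y <= h x & h z <= h x] /\
    [/\ y \in c, z \in c & 4 <= size c -> z <> next c y /\ y <> next c z].
Proof.
move=> [c3 /andP[pc uc]].
have c0 : c != [::] by case: c c3 {pc uc}.
have [x xc xmax] := seq_argmax (h : {classic G} -> nat) c0.
have [n c' nc] := rot_to xc.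
have pc' : cycle (@adjb G) (x :: c') by rewrite -nc rot_cycle.
have uc' : uniq (x :: c') by rewrite -nc rot_uniq.
have nextE v : next c v = next (x :: c') v by rewrite -nc next_rot.
have memE v : (v \in c) = (v \in x :: c') by rewrite -nc mem_rot.
have sz : size c = (size c').+1 by rewrite -(size_rot n) nc.
case: c' pc' uc' nextE memE sz {nc} => [|y c']; first by move: c3 => + _ _ _ _ e; rewrite e.
case/lastP: c' => [|m z] pc' uc' nextE memE sz; first by move: c3; rewrite sz.
exists x, y, z; move: pc'; rewrite /= rcons_path last_rcons.
move=> /and3P[/adjbP xy pz /adjbP zx].
have yc : y \in c by rewrite memE !inE eqxx orbT.
have zc : z \in c by rewrite memE !inE mem_rcons inE eqxx !orbT.
split; split => //; rewrite ?xmax //; first exact: adj_sym.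
  by move=> yz; move: uc'; rewrite yz /= mem_rcons inE eqxx /= !andbF.
move=> c4; rewrite !nextE; split.
  case: m uc' sz {pz memE nextE} => [|m0 m] uc' sz; first by rewrite sz in c4.
  rewrite (@next_consec _ [:: x] (rcons m z) y m0) //.
  by move=> e; move: uc'; rewrite e /= mem_rcons inE eqxx /= !andbF.
rewrite -rcons_cons next_last ?rcons_cons // => e.
by move: uc'; rewrite e /= inE eqxx.
Qed.

Lemma elimination_chordal h : elimination h -> chordal G.
Proof.
move=> hE [c [[cc ci] c4]].
have [x [y [z [[xy xz yz hy hz] [yc zc]]]]] := cycle_top h cc.
move=> /(_ c4)[zy yz'].
have low (v : G) : adj x v -> h v <= h x -> lower h x v.
  by move=> xv hv; split=> //; have := hE.1 _ _ xv; lia.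
have /(ci _ _ yc zc)[] := hE.2 x y z (low _ xy hy) (low _ xz hz) yz.
  by move/zy.
by move/yz'.
Qed.

Lemma subgraph_connected (S : subgraph G) : connected_graph (graph_of S) ->
  sub_vertex S !=set0 /\ connected (sub_vertex S).
Proof.
move=> /connected_graphP[[x] cS]; split; first by exists (sval x); apply: (svalP x).
move=> y z Sy Sz.
suff : forall t, conn [set: graph_of S] (exist _ y Sy) t -> conn (sub_vertex S) y (sval t).
  by move=> /(_ (exist _ z Sz)); apply; apply: cS.
move=> t; elim=> [_|u v _ IH uv _]; first exact: conn_refl.
by apply: (conn_step IH); [apply: sub_adj_adj uv|apply: (svalP v)].
Qed.

Lemma elimination_no_calH h : elimination h -> ~ induced_minor calH G.
Proof.
move=> hE [B [cB dB aB]].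
have disj u v x : sub_vertex (B u) x -> sub_vertex (B v) x -> u = v.
  move=> ux vx; apply: contrapT => /dB uv.
  by have : (sub_vertex (B u) `&` sub_vertex (B v)) x by []; rewrite uv.
have top b : exists2 x, sub_vertex (B (inr b)) x &
    forall y, sub_vertex (B (inr b)) y -> h x <= h y.
  by apply: set_argmin; have [] := subgraph_connected (cB (inr b)).
have [b [x [x' [xB xmin x'B xx']]]] : exists b x x', [/\ sub_vertex (B (inr b)) x,
    (forall y, sub_vertex (B (inr b)) y -> h x <= h y),
    sub_vertex (B (inr (~~ b))) x' & h x' <= h x].
  have [[x xB xm] [y yB ym]] := (top true, top false).
  have [xy|/ltnW xy] := leqP (h x) (h y).
    by exists false, y, x.
  by exists true, x, y.
have touch b' n : exists u v, [/\ sub_vertex (B (inl n)) u,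
    sub_vertex (B (inr b')) v & adj u v].
  by apply/(aB (inl n) (inr b')).
(* The branch set of [inl n] joins those of [x] and [x'] into one connected set, so
   [connected_lower] applies. The vertex found is not in the branch set of [x], by minimality, nor
   in that of [x'], which is not adjacent to it. *)
have meet n : exists y, sub_vertex (B (inl n)) y /\ lower h x y.
  have [_ cn] := subgraph_connected (cB (inl n)).
  have [_ cb] := subgraph_connected (cB (inr b)).
  have [_ cb'] := subgraph_connected (cB (inr (~~ b))).
  have [u [v [un vb uv]]] := touch b n.
  have [u' [v' [u'n v'b uv']]] := touch (~~ b) n.
  have cU := connectedU cn cb un vb (or_intror uv).
  have cU' := connectedU cU cb' (or_introl _ u'n) v'b (or_intror uv').
  have [|y] := connected_lower hE cU' (or_introl _ (or_intror _ xB)) (or_intror _ x'B) _ xx'.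
    move=> e; rewrite -e in x'B; have := disj _ _ _ xB x'B.
    by case=> /esym; case: (b).
  case=> [[yn|yb]|yb] xy; first by exists y.
    by have [_ /=] := xy; rewrite ltnNge xmin.
  have /aB : (inr b : calH) <> inr (~~ b) by case=> /esym; case: (b).
  by case=> _ /=; case; exists x, y; split=> //; case: xy.
have [f fP] := choice meet.
(* The vertices [f n] lie in disjoint branch sets, hence have distinct values, all below [h x]. *)
have injf : injective (h \o f).
  move=> m n /= e; have := lower_inj hE (fP m).2 (fP n).2 e => fmn.
  have := disj (inl m) (inl n) (f m) (fP m).1; rewrite {1}fmn => /(_ (fP n).1).
  by case.
have [i] := nat_inj_unbounded (h x) injf.
by case: (fP i) => _ [_ /=]; rewrite ltnNge => /negP.
Qed.

End Elimination.

(** * Rooted trees *)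

(** [d] only has to increase from parent to child, so both the distance from the root and an
    elimination function can serve as [d]. *)
Record rooted (T : graph) (r : T) (par : T -> T) (d : T -> nat) : Prop := Rooted {
  rooted_adj : forall s t, adj s t -> s = par t \/ t = par s;
  rooted_par : forall t, t <> r -> adj (par t) t;
  rooted_lt : forall t, t <> r -> d (par t) < d t;
  rooted_root : par r = r }.

Section RootedTrees.
Variables (T : graph) (r : T) (par : T -> T) (d : T -> nat).
Hypothesis rT : rooted r par d.

Lemma rooted_adj_lt s t : adj s t -> s = par t -> d s < d t.
Proof.
move=> st e; rewrite e; apply: (rooted_lt rT) => tr.
by apply: (adj_neq st); rewrite e tr (rooted_root rT).
Qed.

Lemma rooted_lower s t : lower d t s -> s = par t.
Proof.
move=> [ts /= st]; case: (rooted_adj rT ts) => // e.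
by have := rooted_adj_lt ts e; lia.
Qed.

(** The only lower neighbour is the parent, so all facts on elimination functions become available
    for trees. *)
Lemma rooted_elimination : elimination d.
Proof.
split=> [s t st|t u v /rooted_lower-> /rooted_lower->//].
case: (rooted_adj rT st) => e; first by have := rooted_adj_lt st e; lia.
by have := rooted_adj_lt (adj_sym st) e; lia.
Qed.

Lemma rooted_ind (P : T -> Prop) :
  P r -> (forall t, t <> r -> P (par t) -> P t) -> forall t, P t.
Proof.
move=> Pr IH t; have [n] := ubnP (d t); elim: n t => // n IHn t dt.
have [->//|tr] := pselect (t = r); apply: IH => //; apply: IHn.
by have := rooted_lt rT tr; lia.
Qed.

Lemma rooted_min t : d r <= d t.
Proof.
elim/rooted_ind: t => // t tr IH; apply: leq_trans IH _.
exact/ltnW/(rooted_lt rT).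
Qed.

Lemma rooted_conn t : conn [set: T] r t.
Proof.
elim/rooted_ind: t => [|t tr IH]; first exact: conn_refl.
exact: conn_step IH (rooted_par rT tr) I.
Qed.

Lemma rooted_is_tree : is_tree T.
Proof.
split.
  apply/connected_graphP; split; first exact: (inhabits r).
  by apply: (@connected_from _ _ r) => t _; apply: rooted_conn.
move=> [c /(cycle_top d)[x [y [z [[xy xz yz hy hz] _]]]]].
have low (v : T) : adj x v -> d v <= d x -> v = par x.
  move=> xv hv; apply: rooted_lower; split=> //.
  by have := rooted_elimination.1 _ _ xv; lia.
by apply: yz; rewrite (low _ xy hy) (low _ xz hz).
Qed.

End RootedTrees.

Section Trees.
Variable T : graph.
Hypothesis tT : is_tree T.

(** If the path left [Q] at [z], its two segments beside [z], joined through [Q], would connect the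
    two neighbours of [z] while avoiding [z], which closes a cycle. *)
Lemma tree_path_sub (Q : set T) (s t : {classic T}) (p : seq {classic T}) :
  connected Q -> Q s -> Q t -> is_path s p t -> forall z, z \in s :: p -> Q z.
Proof.
move=> cQ Qs Qt [[sp pt] up] z; rewrite inE => /orP[/eqP->//|zp].
apply: contrapT => Qz; case/splitPr: zp sp pt up => p1 [|w p2].
  by move=> _; rewrite last_cat => /= zt; case: Qz; rewrite zt.
rewrite cat_path last_cat /= => /and4P[sp1 /adjbP uz /adjbP zw wp2] p2t up.
have NQz : Q `<=` [set~ (z : T)] by move=> v Qv /= vz; apply: Qz; rewrite -vz.
have [zs z1 [zw2 uw]] : [/\ z != s, z \notin p1 & z \notin w :: p2 /\ last s p1 <> w].
  move: up; rewrite cat_uniq => /andP[sp /and3P[_ /hasPn p1N /andP[zwp2 _]]].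
  have zp1 : z \notin p1 by apply: p1N; rewrite in_cons eqxx.
  have wp1 : w \notin p1 by apply: p1N; rewrite !in_cons eqxx orbT.
  split=> //; first by apply: contraNneq sp => ->; rewrite mem_cat in_cons eqxx orbT.
  split=> // e; have := mem_last s p1; rewrite e in_cons (negPf wp1) orbF => /eqP ws.
  by move: sp; rewrite -ws mem_cat !in_cons eqxx !orbT.
case: tT => _; apply; apply: (conn_cycle (adj_sym uz) zw uw).
apply: (@conn_trans _ _ s).
  apply/conn_sym/walk_conn => // v; rewrite inE => /orP[/eqP->|vp1] /= vz.
    by rewrite vz eqxx in zs.
  by rewrite -vz vp1 in z1.
apply: (@conn_trans _ _ t); first exact: conn_sub NQz (cQ _ _ Qs Qt).
rewrite -p2t; apply/conn_sym/walk_conn => // v vp2 /= vz.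
by rewrite -vz vp2 in zw2.
Qed.

(* The parent is a neighbour closer to the root. A second neighbour that is not
   farther from the root would close a cycle. *)
Lemma tree_rooted (r : T) : exists par d, @rooted T r par d.
Proof.
have [cT acyclic] := tT; have [_ /(_ r) walk] := cT.
have ex (t : {classic T}) : exists n, `[< exists2 p, is_walk r p t & size p = n >].
  by have [p pw] := walk t; exists (size p); apply/asboolP; exists p.
pose d (t : T) : nat := ex_minn (ex t).
have dP (t : T) : (exists2 p, is_walk (r : {classic T}) p t & size p = d t) /\
    forall p, is_walk (r : {classic T}) p t -> d t <= size p.
  rewrite /d; case: ex_minnP => n /asboolP nP nmin; split=> // p pw.
  by apply: nmin; apply/asboolP; exists p.
have dr : d r = 0 by apply/eqP; rewrite -leqn0; apply: ((dP r).2 [::]); split.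
have step t : exists u, if `[< t = r >] then u = r else adj u t /\ d u < d t.
  case: asboolP => [_|tr]; first by exists r.
  have [[p [rp pt] <-] _] := dP t.
  case/lastP: p rp pt => [_ /esym//|p u].
  rewrite last_rcons rcons_path => /andP[rp /adjbP pu] ut.
  exists (last (r : {classic T}) p); rewrite -ut size_rcons ltnS; split=> //.
  exact: (dP _).2.
have [par parP] := choice step; exists par, d.
have par_root : par r = r by have := parP r; rewrite asboolT.
have par_ne t : t <> r -> adj (par t) t /\ d (par t) < d t.
  by move=> tr; have := parP t; rewrite asboolF.
(* Passing to parents strictly decreases [d], so the way from [s] up to the root never meets [t]. *)
have up t s : s <> t -> d s <= d t -> conn [set~ t] s r.
  have [n] := ubnP (d s); elim: n s => // n IH s dsn st dst.
  have [e|sr] := pselect (s = r); first by rewrite -e; apply: conn_refl.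
  have [ps dps] := par_ne s sr; have pt : par s <> t by move=> e; rewrite e in dps; lia.
  apply: (@conn_trans _ _ (par s)); [by apply: conn_adj => //; apply: adj_sym|].
  by apply: IH => //; lia.
have main s t : adj s t -> d s <= d t -> s = par t.
  move=> st dst; have tr : t <> r.
    move=> e; move: dst; rewrite e dr leqn0 => /eqP ds0.
    have [[p [_ ps]]] := dP s; rewrite ds0 => p0 _.
    by move/size0nil: p0 ps => -> /= rs; apply: (adj_neq st); rewrite -rs e.
  have [pt dpt] := par_ne _ tr; apply: contrapT => spt.
  apply: acyclic; apply: (conn_cycle (adj_sym st) (adj_sym pt) spt).
  apply: (@conn_trans _ _ r); first by apply: up => //; exact: adj_neq st.
  by apply/conn_sym/up; [exact: adj_neq pt|exact: ltnW].
split=> //; [|by move=> t /par_ne[]|by move=> t /par_ne[]].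
move=> s t st; have [dst|/ltnW dts] := leqP (d s) (d t); [left|right].
  exact: main.
by apply: main => //; apply: adj_sym.
Qed.

End Trees.

(** The ancestors of [t] form a connected set containing [r] and [t], hence contain the path.
    Conversely, the path is a connected set containing [r], so by [connected_lower] it is closed
    under [par]. *)
Lemma tree_leP (T : graph) (r : T) (par : T -> T) (d : T -> nat) (s t : T) :
  rooted r par d -> tree_le r s t <-> exists k, s = iter k par t.
Proof.
move=> rT; have tT := rooted_is_tree rT; split.
  move=> [p [rpt sp]]; pose Q := [set s | exists k, s = iter k par t].
  have Qt : Q t by exists 0.
  have Qpar v : Q v -> Q (par v) by move=> [k ->]; exists k.+1.
  have cQ : connected Q.
    apply: (@connected_from _ _ t) => v [k ->].
    elim: k => [|k IH]; first exact: conn_refl.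
    have [e|nr] := pselect (iter k par t = r); last first.
      apply: (conn_step IH); first exact: adj_sym (rooted_par rT nr).
      exact: Qpar (conn_tgt IH).
    by move: IH; rewrite iterS e (rooted_root rT).
  have Qr : Q r.
    suff : forall v, Q v -> Q r by apply; exact: Qt.
    move=> v; elim/(rooted_ind rT): v => // v _ IH /Qpar; exact: IH.
  exact: (tree_path_sub tT cQ Qr Qt rpt).
move=> [k sk]; have [p rp _] := conn_path (rooted_conn rT t).
exists p; split=> //.
pose X : set T := [set v | (v : {classic T}) \in (r : {classic T}) :: p].
have cX : connected X by case: rp => -[rp _] _; apply: walk_connected.
have Xr : X r by exact: mem_head.
have Xpar v : X v -> X (par v).
  move=> Xv; have [->|vr] := pselect (v = r); first by rewrite (rooted_root rT).
  have [u Xu] := connected_lower (rooted_elimination rT) cX Xv Xr vr (rooted_min rT v).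
  by move/(rooted_lower rT) <-.
have Xt : X t.
  by case: rp => -[_ <-] _; rewrite /X /=; exact: mem_last.
by rewrite -/(X s) sk; elim: k {sk} => //= k; apply: Xpar.
Qed.

(** * From elimination functions to trees *)

Lemma graph_of_inj (G : graph) (S : subgraph G) : injective (sval : graph_of S -> G).
Proof.
case=> x Sx [y Sy] /= e; case: _ / e Sy => Sy.
by congr exist; apply: Prop_irrelevance.
Qed.

Section EliminationTree.
Variable G : graph.
Variable h : G -> nat.
Hypotheses (cG : connected_graph G) (hE : elimination h).

Lemma lower_argmax x : lower h x !=set0 ->
  exists2 y, lower h x y & forall z, lower h x z -> h z <= h y.
Proof.
(* Lower values are below [h x], so the truncated difference is exact and minimising it maximises
   [h y]. *)
move=> /(set_argmin (fun y => h x - h y))[y xy ymax]; exists y => // z xz.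
by have [[_ /= yx] [_ /= zx]] := (xy, xz); have := ymax _ xz; lia.
Qed.

(* Each vertex hangs below its highest lower neighbour; as the lower neighbours
   form a clique, all of them are ancestors. *)
Lemma elimination_tree : exists (S : subgraph G) (r : graph_of S) par,
  [/\ sub_vertex S = setT, rooted r par (h \o sval),
      forall t, t <> r -> lower h (sval t) (sval (par t)) &
      forall t z, lower h (sval t) z -> h z <= h (sval (par t))].
Proof.
have /connected_graphP[[x0] conG] := cG.
have [|r _ rmin] := @set_argmin _ h [set: G]; first by exists x0.
(* By connectedness only the minimum [r] lacks a lower neighbour; there the default is [r] itself,
   as [rooted_root] demands. *)
have step x : exists y, if `[< x = r >] then y = r
    else lower h x y /\ forall z, lower h x z -> h z <= h y.
  case: asboolP => [_|xr]; first by exists r.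
  have [z _ xz] := connected_lower hE conG I I xr (rmin x I).
  by have [|y xy ymax] := @lower_argmax x; [exists z|exists y].
have [par parP] := choice step.
have par_r : par r = r by have := parP r; rewrite asboolT.
have par_lower x : x <> r -> lower h x (par x).
  by move=> xr; have := parP x; rewrite asboolF // => -[].
have lower_r z : ~ lower h r z by case=> _ /=; rewrite ltnNge rmin.
have par_max x z : lower h x z -> h z <= h (par x).
  have := parP x; case: asboolP => [->|_ [_ ymax]]; last exact: ymax.
  by move=> _ /lower_r.
(* Excluding [r] prevents the loop that [par r = r] would create. *)
pose sadj x y := (x = par y /\ y <> r) \/ (y = par x /\ x <> r).
have sadj_sym x y : sadj x y -> sadj y x by case; [right|left].
have sadj_vertex x y : sadj x y -> [set: G] x by [].
have sadj_adj x y : sadj x y -> adj x y.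
  by case=> -[->] /par_lower[] // + _; apply: adj_sym.
pose S := Subgraph sadj_sym sadj_vertex sadj_adj.
have inj : injective (sval : graph_of S -> G) := @graph_of_inj _ _.
pose rT : graph_of S := exist _ r I.
have ne t : t <> rT -> sval t <> r by move=> trT tr; apply: trT; apply: inj.
exists S, rT, (fun t => exist _ (par (sval t)) I); split=> //=.
- split=> [s t [[st _]|[ts _]]|t /ne tr|t /ne /par_lower[]|] //.
  + by left; apply: inj.
  + by right; apply: inj.
  + by left.
  + exact: inj.
- by move=> t /ne /par_lower.
- by move=> t z /par_max.
Qed.

Lemma elimination_nst : has_normal_spanning_tree G.
Proof.
have [S [r [par [SV rT parL parM]]]] := elimination_tree.
exists S, r; split=> //; first exact: rooted_is_tree rT.
(* Induction along parents: a lower neighbour of [x] other than [par x] is adjacent to [par x] and,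
   by maximality of [par x], lower than it. *)
have anc (x y : graph_of S) : lower h (sval x) (sval y) -> tree_le r y x.
  move=> xy; apply/(tree_leP _ _ rT).
  elim/(rooted_ind rT): x xy => [|x xr IH] xy.
    by have := rooted_min rT y; rewrite leqNgt => /negP; case; case: xy.
  have [yx|yx] := pselect (y = par x); first by exists 1.
  have [|k ->] := IH; last by exists k.+1; rewrite iterSr.
  have px := parL _ xr.
  have nyx : sval (par x) <> sval y by move=> /graph_of_inj/esym.
  have pxy : adj (sval (par x)) (sval y) by apply: hE.2 px xy nyx.
  split=> //=; have := parM _ _ xy; have := hE.1 _ _ pxy; lia.
move=> x y /(lower_or hE)[/anc|/anc]; by [right|left].
Qed.

Lemma elimination_tree_decomposition : has_tree_decomposition_into_finite_cliques G.
Proof.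
have [S [r [par [SV rT parL parM]]]] := elimination_tree.
pose V (t : graph_of S) : set G := [set x | x = sval t \/ lower h (sval t) x].
have lift x : exists t : graph_of S, sval t = x.
  by suff Sx : sub_vertex S x; [exists (exist _ x Sx)|rewrite SV].
have VL t x : V t x -> x <> sval t -> lower h (sval t) x by case.
exists (graph_of S), V; split; last first.
  move=> t; split.
    have -> : V t = [set sval t] `|` lower h (sval t) by [].
    by rewrite finite_setU; split; [exact: finite_set1|exact: lower_finite].
  move=> x y [->|tx] [->|ty] // xy; last exact: hE.2 tx ty xy.
    by case: ty.
  by case: tx => tx _; apply: adj_sym.
split; first exact: rooted_is_tree rT.
- by move=> x; have [t <-] := lift x; exists t; left.
- move=> x y /(lower_or hE)[xy|yx].
    by have [t tx] := lift x; exists t; rewrite /V /= tx; split; [left|right].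
  by have [t ty] := lift y; exists t; rewrite /V /= ty; split; [right|left].
move=> t1 t2 t3 [p [t13 t2p]] x [V1 V3].
pose Q : set (graph_of S) := [set t | V t x].
apply: (@tree_path_sub _ (rooted_is_tree rT) Q _ _ _ _ V1 V3 t13 _ t2p).
have [t0 t0x] := lift x.
(* Going up from a node whose part contains [x], all parts contain [x] until the node [t0] of [x]
   itself is reached. *)
apply: (@connected_from _ _ t0) => t Qt; apply: conn_sym.
have Q0 t' : sval t' = x -> t' = t0 by rewrite -t0x => /graph_of_inj.
elim/(rooted_ind rT): t Qt => [|t tr IH] Qt.
  case: (Qt) => [e|[_ /=]]; first by rewrite -(Q0 _ (esym e)); apply: conn_refl.
  by rewrite -t0x ltnNge (rooted_min rT t0).
case: (Qt) => [e|tx]; first by rewrite -(Q0 _ (esym e)); apply: conn_refl.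
have Qp : Q (par t).
  have [xp|xp] := pselect (x = sval (par t)); first by left.
  have pt := parL _ tr.
  have px : adj (sval (par t)) x by apply: hE.2 pt tx _ => /esym.
  by right; split=> //=; have := parM _ _ tx; have := hE.1 _ _ px; lia.
apply: (@conn_trans _ _ (par t)); last exact: IH.
by apply: conn_adj => //; apply: adj_sym; apply: (rooted_par rT tr).
Qed.

End EliminationTree.

(** * Elimination functions from tree-decompositions *)

Lemma finite_bound (T : Type) (A : set T) (P : nat -> T -> Prop) : finite_set A ->
  (forall m n x, m <= n -> P m x -> P n x) -> (forall x, A x -> exists n, P n x) ->
  exists n, forall x, A x -> P n x.
Proof.
move=> /(@finite_seqP {classic T})[s ->] Pmono.
elim: s => [|x s IH] Ps; first by exists 0.
have [y ys|n nP] := IH; first by apply: Ps; rewrite /= in_cons ys orbT.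
have [|m mP] := Ps x; first exact: mem_head.
exists (maxn m n) => y /=; rewrite in_cons => /orP[/eqP->|ys].
  by apply: Pmono mP; apply: leq_maxl.
by apply: Pmono (nP _ ys); apply: leq_maxr.
Qed.

Section LexicographicRank.
Variables (G : graph) (r1 r2 : G -> nat).

Definition lex_lower x : set G :=
  [set y | adj x y /\ (r1 y < r1 x \/ (r1 y = r1 x /\ r2 y < r2 x))].

(** The lexicographic order of two ranks need not embed into [nat]. As each vertex has finitely many
    lower neighbours, descending chains from it have bounded length; [h] is the largest number of
    vertices in such a chain. *)
Lemma elimination_of_rank :
  (forall x y, adj x y -> r1 x = r1 y -> r2 x <> r2 y) ->
  (forall x, finite_set (lex_lower x) /\ clique (lex_lower x)) ->
  exists h : G -> nat, elimination h.
Proof.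
move=> r12 lowP.
pose fix bounded (n : nat) (x : G) {struct n} : Prop :=
  if n is m.+1 then forall y, lex_lower x y -> bounded m y else False.
have bdS n x : bounded n x -> bounded n.+1 x.
  elim: n x => // n IH x xn y xy; apply: IH; exact: xn.
have bd_mono m n x : m <= n -> bounded m x -> bounded n x.
  by move=> /subnK <-; elim: (n - m) => // k IH /IH /bdS.
have ex x : exists n, `[< bounded n x >].
  have [a] := ubnP (r1 x); have [b] := ubnP (r2 x).
  elim: a b x => // a IHa; elim=> // b IHb x xb xa.
  have [y xy|n nP] := finite_bound (lowP x).1 bd_mono.
    suff : exists n, `[< bounded n y >] by case=> n /asboolP; exists n.
    case: xy => _ [yx|[e yx]]; first by apply: (IHa (r2 y).+1) => //; lia.
    by apply: IHb => //; lia.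
  by exists n.+1; apply/asboolP.
pose h x := ex_minn (ex x); exists h.
have hP x : bounded (h x) x /\ forall n, bounded n x -> h x <= n.
  rewrite /h; case: ex_minnP => n /asboolP xn nmin; split=> // m xm.
  by apply: nmin; apply/asboolP.
have h_lt x y : lex_lower x y -> h y < h x.
  move=> xy; have [] := hP x; case: (h x) => // m xm _.
  by rewrite ltnS; apply: (hP y).2; apply: xm.
have low_or x y : adj x y -> lex_lower x y \/ lex_lower y x.
  move=> xy; have yx := adj_sym xy; have := r12 _ _ xy; rewrite /lex_lower /=.
  case: (ltngtP (r1 x) (r1 y)) => [||e /(_ e) ne].
  - by right; split; [|left].
  - by left; split; [|left].
  case: (ltngtP (r2 x) (r2 y)) => // ?; first by right; split=> //; right.
  by left; split=> //; right.
split=> [x y /low_or[] /h_lt|x]; [lia|lia|].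
apply: clique_sub (lowP x).2 => y [xy /= yx].
by case: (low_or _ _ xy) => // /h_lt; lia.
Qed.

End LexicographicRank.

Lemma tree_decomposition_elimination (G : graph) :
  has_tree_decomposition_into_finite_cliques G -> exists h : G -> nat, elimination h.
Proof.
move=> [T [V [[tT Vcover Vedge Vconv] Vfc]]].
have [[[r] _] _] := tT; have [par [d rT]] := tree_rooted tT r.
have dE := rooted_elimination rT.
have cV x : connected [set t | V t x].
  move=> s t Vs Vt; have /connected_graphP[_ cT] := tT.1.
  have [p pst _] := conn_path (cT s t I I).
  have [[sp pt] _] := pst; rewrite -[t]pt; apply: walk_conn => // z zp.
  by apply: (Vconv s z t) => //; exists p.
have ex x : exists t, V t x /\ forall s, V s x -> d t <= d s.
  by have [|t Vt tmin] := @set_argmin _ d [set t | V t x]; [exact: Vcover|exists t].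
have [top topP] := choice ex.
have top_uniq x s : V s x -> d s <= d (top x) -> top x = s.
  have [Vt tmin] := topP x; move=> Vs; exact: (connected_argmin_uniq dE (cV x)).
have par_in x s : V s x -> d (top x) < d s -> V (par s) x.
  move=> Vs ts; have ne : s <> top x by move=> e; rewrite -e ltnn in ts.
  have [u Vu /(rooted_lower rT) <-//] := connected_lower dE (cV x) Vs (topP x).1 ne (ltnW ts).
(* A part containing both [x] and [y] can be replaced by its parent part as long as it lies strictly
   below [top x]. *)
have top_in x y s : V s x -> V s y -> d (top y) <= d (top x) -> V (top x) y.
  move=> + + yx; elim/(rooted_ind rT): s => [|s sr IH] Vx Vy.
    by rewrite (top_uniq _ _ Vx) // (rooted_min rT).
  have [sx|xs] := leqP (d s) (d (top x)); first by rewrite (top_uniq _ _ Vx).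
  by apply: IH; apply: par_in => //; exact: leq_ltn_trans yx xs.
have exs t : exists s : seq {classic G}, V t = [set` s].
  exact/(@finite_seqP {classic G})/(Vfc t).1.
have [enum enumP] := choice exs.
(* Adjacent vertices with equal [r1] have the same topmost part, where the index in its enumeration
   tells them apart. *)
pose r1 x := d (top x); pose r2 (x : G) := index (x : {classic G}) (enum (top x)).
have adj_in x y : adj x y -> r1 y <= r1 x -> V (top x) y.
  by move=> xy; have [s [Vx Vy]] := Vedge _ _ xy; apply: top_in Vx Vy.
apply: (@elimination_of_rank _ r1 r2).
  move=> x y xy exy e2.
  have exy' : top x = top y.
    by apply: esym; apply: top_uniq; [apply: adj_in; rewrite ?exy|rewrite -/(r1 x) exy].
  have xV : V (top x) x := (topP x).1.
  have yV : V (top x) y by rewrite exy'; exact: (topP y).1.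
  apply: (adj_neq xy); move: e2; rewrite /r2 -exy'.
  rewrite enumP in xV yV.
  by move=> /(congr1 (nth (x : {classic G}) (enum (top x)))); rewrite !nth_index.
have sub x : lex_lower r1 r2 x `<=` V (top x).
  by move=> y [xy yx]; apply: adj_in => //; case: yx => [/ltnW|[->]].
move=> x; split; first exact: sub_finite_set (sub x) (Vfc _).1.
exact: clique_sub (sub x) (Vfc _).2.
Qed.

(** * Heights and least elements in normal spanning trees *)

Section RootedOrder.
Variables (T : graph) (r : T) (par : T -> T) (d : T -> nat).
Hypothesis rT : rooted r par d.

Lemma iter_par_le k t : d (iter k par t) <= d t.
Proof.
elim: k => //= k; apply: leq_trans; set s := iter k par t.
have [->|sr] := pselect (s = r); first by rewrite (rooted_root rT).
by apply/ltnW/(rooted_lt rT).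
Qed.

Lemma iter_par_fix k t : d t <= d (iter k par t) -> iter k par t = t.
Proof.
case: k => // k; rewrite iterSr => tk.
have [e|tr] := pselect (t = r).
  by rewrite e; elim: k {tk} => [|k IH]; rewrite /= ?IH (rooted_root rT).
by have := iter_par_le k (par t); have := rooted_lt rT tr; lia.
Qed.

(** The ancestors of [t] form a chain. If [j <= k], the hypothesis on heights forces the two
    iterates to coincide. *)
Lemma iter_par_total j k t : d (iter j par t) <= d (iter k par t) ->
  exists i, iter j par t = iter i par (iter k par t).
Proof.
have [kj _|/ltnW jk le] := leqP k j.
  by exists (j - k); rewrite -iterD subnK.
exists 0; move: le; rewrite -(subnK jk) iterD => /iter_par_fix /= e.
by rewrite e.
Qed.

End RootedOrder.

(* In a normal spanning tree every connected set of vertices has a least element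
   in the tree-order; only its height matters in what follows. *)
Lemma nst_rank (G : graph) : has_normal_spanning_tree G ->
  exists h : G -> nat, forall C : set G, connected C -> C !=set0 ->
    exists2 m, C m & forall v, C v -> v <> m -> h m < h v.
Proof.
move=> [S [r [SV tS normal]]].
have [par [d rT]] := tree_rooted tS r.
have lift_ex x : exists t : graph_of S, sval t = x.
  by suff Sx : sub_vertex S x; [exists (exist _ x Sx)|rewrite SV].
have [lift liftP] := choice lift_ex.
exists (d \o lift) => C cC /(set_argmin (d \o lift))[m Cm mmin]; exists m => // v Cv vm.
(* Along a walk in [C] from [m], each edge leads to an ancestor or a descendant. When it leads up,
   minimality of [m] keeps the new vertex below or at [m]. *)
have anc : exists k, lift m = iter k par (lift v).
  elim: (cC _ _ Cm Cv) => [_|u w mu [k mk] uw Cw]; first by exists 0.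
  have : adj (sval (lift u)) (sval (lift w)) by rewrite !liftP.
  move=> /normal[] /(tree_leP _ _ rT)[j].
    by move=> uj; exists (k + j); rewrite iterD -uj.
  move=> wj; have := mmin _ Cw; rewrite /= mk wj => /(iter_par_total rT)[i ->].
  by exists i.
have [k mk] := anc; have /= := mmin _ Cv; rewrite leq_eqVlt => /orP[/eqP e|//].
case: vm; rewrite -(liftP v) -(liftP m) mk (iter_par_fix rT) //.
by rewrite -mk e.
Qed.

(** * Separators in chordal graphs *)

Definition consec (T : Type) (w : seq T) (x y : T) : Prop :=
  exists w1 w2, w = w1 ++ x :: y :: w2.

Lemma infinite_injection (T : Type) (A : set T) : infinite_set A ->
  exists f : nat -> T, injective f /\ forall n, A (f n).
Proof.
move=> /infiniteP/card_leP[f].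
exists (fun n => val (f (SigSub (mem_setT n)))); split=> [m n|n].
  by move=> /val_inj/inj; rewrite !in_setT => /(_ isT isT) [].
exact: set_mem (valP (f (SigSub (mem_setT n)))).
Qed.

Section Separators.
Variable G : graph.

(** A shortest path within [D] is induced, since an edge between non-consecutive vertices would
    shorten it. *)
Lemma geodesic_induced (D : set G) (s t : {classic G}) : conn D s t ->
  exists p : seq {classic G}, [/\ is_path s p t, forall z, z \in s :: p -> D z &
    forall x y : {classic G}, x \in s :: p -> y \in s :: p -> adj (x : G) y ->
      consec (s :: p) x y \/ consec (s :: p) y x].
Proof.
move=> /conn_path[p0 p0st p0D].
have ex : exists n, `[< exists p, [/\ is_path s p t,
    forall z, z \in s :: p -> D z & size p = n] >].
  by exists (size p0); apply/asboolP; exists p0.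
case: (ex_minnP ex) => n /asboolP[p [pst pD pn]] nmin.
have short p' : is_path s p' t -> {subset s :: p' <= s :: p} -> size p <= size p'.
  move=> p'st p'p; rewrite pn; apply: nmin; apply/asboolP; exists p'; split=> //.
  by move=> z /p'p; apply: pD.
exists p; split=> //.
have fwd (x y : {classic G}) w1 w2 : s :: p = w1 ++ x :: w2 -> y \in w2 ->
    adj (x : G) y -> consec (s :: p) x y.
  move=> spE /splitPr yw2; case: yw2 spE => [[|z m] w3] spE xy.
    by exists w1, w3.
  have [[sp pt] up] := pst.
  have sub : subseq (w1 ++ x :: y :: w3) (s :: p).
    rewrite spE; apply: cat_subseq; first exact: subseq_refl.
    apply: (@cat_subseq _ [:: x] _ [:: x]); first exact: subseq_refl.
    exact: suffix_subseq.
  have u' := subseq_uniq sub up.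
  case: w1 spE sub u' => [|s' w1] [es e2] sub u'; rewrite -es in sub u'.
    suff H : is_path s (y :: w3) t.
      by have := short _ H (mem_subseq sub); rewrite e2 /= size_cat /=; lia.
    move: sp pt; rewrite e2 /= cat_path last_cat /=.
    move=> /and4P[_ _ _ w3P] w3t; split=> //; split=> //=.
    by rewrite w3P andbT; apply/adjbP; rewrite es.
  suff H : is_path s (w1 ++ x :: y :: w3) t.
    have := short _ H (mem_subseq sub); rewrite e2 !size_cat /= size_cat /=; lia.
  move: sp pt; rewrite e2 !cat_path !last_cat /= cat_path last_cat /=.
  move=> /and5P[sw1 xw1 _ _ /andP[_ w3P]] w3t; split=> //; split; last by rewrite last_cat.
  by rewrite cat_path /= w3P sw1 xw1 andbT /=; apply/adjbP.
move=> x y xp yp xy; case/splitPr spE: {-}_ / xp => [w1 w2].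
move: yp; rewrite spE mem_cat in_cons => /or3P[yw1|/eqP yx|yw2].
- right; rewrite -spE; case/splitPr: yw1 spE => v1 v2 spE.
  apply: (fwd y x v1 (v2 ++ x :: w2)); first by rewrite spE -catA.
    by rewrite mem_cat in_cons eqxx orbT.
  exact: adj_sym.
- by case: (adj_neq xy).
- by left; rewrite -spE; apply: fwd spE yw2 xy.
Qed.

(** The path is a geodesic in [A] with [s] and [t] added; its interior [q] is nonempty because [s]
    and [t] are not adjacent. *)
Lemma connected_link (A : set G) (s t : {classic G}) :
  connected A -> ~ A s -> ~ A t -> nb A s -> nb A t -> s <> t -> ~ adj (s : G) t ->
  exists q : seq {classic G},
    [/\ q != [::], path (@adjb G) s (rcons q t), uniq (s :: rcons q t),
        forall z, z \in q -> A z &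
        forall x y : {classic G}, x \in s :: rcons q t -> y \in s :: rcons q t ->
          adj (x : G) y -> consec (s :: rcons q t) x y \/ consec (s :: rcons q t) y x].
Proof.
move=> cA As At [s' As' ss'] [t' At' tt'] st nst.
pose D : set G := A `|` [set (s : G)] `|` [set (t : G)].
have AD : A `<=` D by move=> ? ?; left; left.
have : conn D s t.
  apply: (@conn_trans _ _ s'); first by apply: conn_adj => //; [left; right|exact: AD].
  apply: (@conn_trans _ _ t'); first exact: conn_sub AD (cA _ _ As' At').
  by apply: conn_adj; [exact: AD|right|exact: adj_sym].
move=> /geodesic_induced[p [[[sp pt] up] pD pI]].
case/lastP: p sp pt up pD pI => [_ /= /st//|q t0] sp.
rewrite last_rcons => e; rewrite e in sp *; move=> up pD pI; exists q; split=> //.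
  by case: q sp {up pD pI} => //= /andP[/adjbP].
move=> z zq; have : D z.
  by apply: pD; rewrite in_cons mem_rcons in_cons zq !orbT.
move: up; rewrite cons_uniq rcons_uniq mem_rcons in_cons negb_or.
move=> /andP[/andP[_ sq] /andP[tq _]].
case=> [[//|/= zs]|/= zt]; first by rewrite -zs zq in sq.
by rewrite -zt zq in tq.
Qed.

(* Two non-adjacent vertices of the separator would be joined by induced paths
   through both sides, and these form an induced cycle. *)
Lemma separator_clique (A D : set G) : chordal G -> connected A -> connected D ->
  A `&` D = set0 -> nb A `&` D = set0 -> clique (nb A `&` nb D).
Proof.
move=> chG cA cD AD NAD.
have sepP x : A x -> D x -> False by move=> Ax Dx; rewrite -[False]/(set0 x) -AD.
have nadj x y : A x -> D y -> ~ adj x y.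
  move=> Ax Dy xy; rewrite -[False]/(set0 y) -NAD; split=> //.
  by exists x => //; apply: adj_sym.
have nA x : nb D x -> ~ A x by move=> [y Dy xy] Ax; apply: nadj Ax Dy xy.
have nD x : nb A x -> ~ D x by move=> [y Ay xy] Dx; apply: nadj Ay Dx (adj_sym xy).
move=> s t [sA sD] [tA tD] st; apply: contrapT => nst; apply: chG.
have [q [q0 qP qU qA qI]] := connected_link cA (nA s sD) (nA t tD) sA tA st nst.
have ts : t <> s by move=> /esym.
have nts : ~ adj t s by move=> /adj_sym.
have [q' [q'0 q'P q'U q'D q'I]] := connected_link cD (nD t tA) (nD s sA) tD sD ts nts.
pose S : {classic G} := s; pose R : {classic G} := t.
pose c := S :: q ++ R :: q'.
have c4 : 4 <= size c.
  rewrite /c /= size_cat /= addnS !ltnS.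
  by case: (q) q0 => // ? ?; case: (q') q'0 => // ? ? _ _; rewrite /= addSn addnS.
(* Read from [S], the cycle starts with the whole path through [A]; read from [R], with the whole
   path through [D]. Thus consecutive vertices of either path are consecutive under [next c]. *)
have cE1 : c = (S :: rcons q R) ++ q' by rewrite /c /= cat_rcons.
have cE2 : rot (size (S :: q)) c = (R :: rcons q' S) ++ q.
  by rewrite /c -cat_cons rot_size_cat /= cat_rcons.
have cU : uniq c.
  rewrite cE1 cat_uniq qU /=; apply/andP; split.
    apply/hasPn => z zq'; rewrite /= in_cons mem_rcons in_cons; apply/negP.
    case/or3P=> [/eqP zs|/eqP zt|/qA Az].
    - by apply: (nD s sA); rewrite -[s]zs; apply: q'D.
    - by apply: (nD t tA); rewrite -[t]zt; apply: q'D.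
    - by apply: sepP Az (q'D _ zq').
  by move: q'U => /=; rewrite rcons_uniq => /and3P[].
have cC : cycle (@adjb G) c.
  rewrite /c /= rcons_cat rcons_cons -cat_rcons cat_path qP.
  by rewrite last_rcons.
exists c; split=> //; split; first by split; [exact: ltnW|rewrite /ucycle cC].
have next1 x y : consec (S :: rcons q R) x y -> next c x = y.
  move=> [w1 [w2 e]]; move: cU; rewrite cE1 e -catA => u.
  exact: next_consec.
have next2 x y : consec (R :: rcons q' S) x y -> next c x = y.
  move=> [w1 [w2 e]]; rewrite -(next_rot (size (S :: q)) cU).
  move: cU; rewrite -(rot_uniq (size (S :: q))) cE2 e -catA => u.
  exact: next_consec.
have memc x : x \in c -> [\/ x = S, x = R, x \in q | x \in q'].
  rewrite /c in_cons mem_cat in_cons.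
  by case/or4P=> [/eqP|?|/eqP|?];
    [constructor 1|constructor 3|constructor 2|constructor 4].
have m1 x : [\/ x = S, x = R | x \in q] -> x \in S :: rcons q R.
  by rewrite in_cons mem_rcons in_cons; case=> [->|->|->]; rewrite ?eqxx ?orbT.
have m2 x : [\/ x = S, x = R | x \in q'] -> x \in R :: rcons q' S.
  by rewrite in_cons mem_rcons in_cons; case=> [->|->|->]; rewrite ?eqxx ?orbT.
have done1 (x y : {classic G}) :
    [\/ x = S, x = R | x \in q] -> [\/ y = S, y = R | y \in q] ->
    adj (x : G) y -> y = next c x \/ x = next c y.
  by move=> /m1 xm /m1 ym xy; case: (qI _ _ xm ym xy) => /next1 <-; [left|right].
have done2 (x y : {classic G}) :
    [\/ x = S, x = R | x \in q'] -> [\/ y = S, y = R | y \in q'] ->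
    adj (x : G) y -> y = next c x \/ x = next c y.
  by move=> /m2 xm /m2 ym xy; case: (q'I _ _ xm ym xy) => /next2 <-; [left|right].
(* Pairs on one of the two paths are settled by its being induced; the remaining pairs have one
   vertex in [A] and one in [D]. *)
move=> x y /memc[xc|xc|xc|xc] /memc[yc|yc|yc|yc] xy;
  try (by apply: done1 => //; (constructor 1 + constructor 2 + constructor 3));
  try (by apply: done2 => //; (constructor 1 + constructor 2 + constructor 3)).
- by case: (nadj _ _ (qA _ xc) (q'D _ yc) xy).
- by case: (nadj _ _ (qA _ yc) (q'D _ xc) (adj_sym xy)).
Qed.

Definition induced_subgraph (D : set G) : subgraph G.
Proof.
apply: (@Subgraph G D (fun x y => [/\ D x, D y & adj x y])) =>
  [x y [Dx Dy]|x y []|x y []] //.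
by move=> xy; split=> //; apply: adj_sym.
Defined.

Lemma connected_induced_subgraph (D : set G) :
  connected D -> D !=set0 -> connected_graph (graph_of (induced_subgraph D)).
Proof.
move=> cD [x Dx]; apply/connected_graphP; split; first exact: (inhabits (exist _ x Dx)).
move=> [u Du] [v Dv] _ _.
suff H w : conn D u w ->
    forall Dw : D w,
      conn setT (exist _ u Du : graph_of (induced_subgraph D)) (exist _ w Dw).
  exact: H (cD _ _ Du Dv) Dv.
elim=> [Du' Dw|y z uy IH yz Dz Dw].
  by rewrite (Prop_irrelevance Dw Du); apply: conn_refl.
by have Dy := conn_tgt uy; apply: (conn_step (IH Dy)).
Qed.

(* An infinite separator would be the infinite clique of an induced [calH] minor
   whose two further branch sets are the two sides. *)
Lemma separator_finite (A D : set G) : chordal G -> ~ induced_minor calH G ->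
  connected A -> connected D -> A `&` D = set0 -> nb A `&` D = set0 ->
  finite_set (nb A `&` nb D).
Proof.
move=> chG noH cA cD AD NAD; apply: contrapT => /infinite_injection[f [injf fS]].
have Scl := separator_clique chG cA cD AD NAD.
have nadj x y : A x -> D y -> ~ adj x y.
  move=> Ax Dy xy; rewrite -[False]/(set0 y) -NAD; split=> //.
  by exists x => //; apply: adj_sym.
pose Bs (v : calH) : set G :=
  match v with inl n => [set f n] | inr true => A | inr false => D end.
have Bne v : Bs v !=set0.
  case: v => [n|[]]; first by exists (f n).
    by have [[x Ax _] _] := fS 0; exists x.
  by have [_ [x Dx _]] := fS 0; exists x.
have Bc v : connected (Bs v).
  by case: v => [n|[]] //; exact: connected1.
have fA n : ~ A (f n) by move=> An; have [_ [y Dy ny]] := fS n; apply: nadj An Dy ny.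
have fD n : ~ D (f n).
  by move=> Dn; have [[y Ay ny] _] := fS n; apply: nadj Ay Dn (adj_sym ny).
have Bd u v x : u <> v -> Bs u x -> Bs v x -> False.
  case: u v => [m|[]] [n|[]] //=.
  - by move=> mn -> /injf e; apply: mn; rewrite e.
  - by move=> _ -> /fA.
  - by move=> _ -> /fD.
  - by move=> _ + e; rewrite e => /fA.
  - by move=> _ Ax Dx; rewrite -[False]/(set0 x) -AD.
  - by move=> _ + e; rewrite e => /fD.
  - by move=> _ Ax Dx; rewrite -[False]/(set0 x) -AD.
apply: noH; exists (fun v => induced_subgraph (Bs v)); split.
- by move=> v; apply: connected_induced_subgraph.
- by move=> u v uv; apply/seteqP; split=> // x [/= ux vx]; apply: (Bd _ _ _ uv ux vx).
move=> u v uv; rewrite /=; split.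
  case: u v uv => [m|[]] [n|[]] //= _.
  - move=> mn; exists (f m), (f n); split=> //; apply: Scl => //.
    by move=> /injf.
  - by move=> _; have [[x Ax nx] _] := fS m; exists (f m), x.
  - by move=> _; have [_ [x Dx nx]] := fS m; exists (f m), x.
  - by move=> _; have [[x Ax nx] _] := fS n; exists x, (f n); split=> //; apply: adj_sym.
  - by move=> _; have [_ [x Dx nx]] := fS n; exists x, (f n); split=> //; apply: adj_sym.
case=> x [y []].
case: u v uv => [m|[]] [n|[]] //=.
- by move=> mn _ _ _ e; apply: mn; rewrite e.
- by move=> _ Ax Dy /nadj; apply.
- by move=> _ Dx Ay /adj_sym/nadj; apply.
Qed.

End Separators.

(** * Reaching a vertex in finitely many steps *)

Section Exploration.
Variable G : graph.
Hypotheses (chG : chordal G) (noH : ~ induced_minor calH G).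
Implicit Types (B C D W : set G) (l : seq {classic G}).

Definition seqset l : set G := [set z | (z : {classic G}) \in l].

(* [nb C] may meet [C]; its part outside [C] is [bd C]. *)
Definition bd C : set G := ~` C `&` nb C.

Definition clique_attached B := forall D, connected D -> B `&` D = set0 ->
  finite_set (B `&` nb D) /\ clique (B `&` nb D).

(** All of [B] counts as earlier than [l]. *)
Definition elimination_seq B l := forall v : {classic G}, v \in l ->
  clique [set u : G | adj u v /\
    (B u \/ ((u : {classic G}) \in l /\ index (u : {classic G}) l < index v l))].

Lemma clique_attached_bd C : clique_attached (~` C) -> connected C ->
  finite_set (bd C) /\ clique (bd C).
Proof. by move=> gC cC; apply: gC => //; rewrite setICl. Qed.

Lemma clique_attached_compl C :
  finite_set (bd C) -> clique (bd C) -> clique_attached (~` C).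
Proof.
move=> fC kC D _ CD; have DC : D `<=` C.
  by move=> z Dz; apply: contrapT => Cz; rewrite -[False]/(set0 z) -CD.
have sub : ~` C `&` nb D `<=` bd C by move=> z [Cz Dz]; split=> //; apply: nb_sub Dz.
by split; [apply: sub_finite_set fC|apply: clique_sub kC].
Qed.

(* [C] is a component of the vertices still to be processed, and [x] the vertex
   of [C] that is to be reached. *)
Definition stage x C := [/\ connected C, C x & clique_attached (~` C)].

Definition away x k C : set G := component (C `\` nb [set k]) x.

Definition below x D C := exists k, [/\ bd C k, ~ adj x k & D = away x k C].

Lemma away_sub x k C : away x k C `<=` C.
Proof. by move=> z /component_sub[]. Qed.

Lemma away_nadj x k C z : away x k C z -> ~ adj z k.
Proof. by move=> /component_sub[_ zk] /(nb1 k z)/zk. Qed.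

(** Inside [C], a boundary vertex not adjacent to [k] would belong to the component. Outside [C] it
    lies in the clique [bd C], which contains [k]. *)
Lemma away_bd x k C z : stage x C -> bd C k -> bd (away x k C) z -> adj z k.
Proof.
move=> [cC Cx gC] Nk [Dz zD]; apply: contrapT => zk.
have [Cz|Cz] := pselect (C z).
  by apply: Dz; apply: component_nb => //; split=> // /nb1.
have [zk'|zk'] := pselect (z = k).
  by case: zD => y /away_nadj ky; rewrite zk' => /adj_sym.
apply: zk; apply: (clique_attached_bd gC cC).2 => //; split=> //.
exact: nb_sub (@away_sub x k C) _ zD.
Qed.

(** By [away_bd], the boundary lies in the common neighbourhood of [[set k]] and [D], to which the
    separator lemmas apply. *)
Lemma away_stage x k C : stage x C -> bd C k -> ~ adj x k -> stage x (away x k C).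
Proof.
move=> sC Nk xk; have [cC Cx gC] := sC; set D := away x k C.
have cD : connected D := @component_connected _ _ _.
have sub : bd D `<=` nb [set k] `&` nb D.
  by move=> z Dz; split; [apply/nb1; apply: away_bd Dz|case: Dz].
have kD : [set k] `&` D = set0.
  by apply/seteqP; split=> // _ [/= -> /away_sub]; case: Nk.
have nkD : nb [set k] `&` D = set0.
  by apply/seteqP; split=> // z [/nb1 zk /away_nadj].
split=> //; first by apply: component_refl; split=> // /nb1.
apply: clique_attached_compl.
  by apply: sub_finite_set sub (separator_finite _ _ _ cD kD nkD) => //; exact: connected1.
by apply: clique_sub sub (separator_clique _ _ cD kD nkD) => //; exact: connected1.
Qed.

Lemma below_stage x C D : stage x C -> below x D C -> stage x D.
Proof. by move=> sC [k [Nk xk ->]]; apply: away_stage. Qed.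

(* In a descending sequence the vertices [k n] form a ray. If [M] is the component
   of [x] after deleting this ray and its neighbours, then [bd M] is finite and so
   disjoint from some [C n]; hence [C n] lies in [M], although [k n] has a
   neighbour in [C n]. *)
Lemma no_descent x (C : nat -> set G) (k : nat -> G) : (forall n, stage x (C n)) ->
  (forall n, [/\ bd (C n) (k n), ~ adj x (k n) & C n.+1 = away x (k n) (C n)]) -> False.
Proof.
move=> stC kP; pose A : set G := range k.
have cA : connected A.
  apply: (@connected_from _ _ (k 0)) => _ [n _ <-].
  elim: n => [|n IH]; first by apply: conn_refl; exists 0.
  apply: (conn_step IH); last by exists n.+1.
  have [Nk xk Cn1] := kP n; have [Nk1 _ _] := kP n.+1.
  by rewrite Cn1 in Nk1; apply/adj_sym/(away_bd (stC n) Nk).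
have Cdec n m : C (n + m) `<=` C n.
  elim: m => [|m IH]; first by rewrite addn0.
  by rewrite addnS; have [_ _ ->] := kP (n + m) => z /away_sub /IH.
pose M := component (~` (A `|` nb A)) x.
have Mx : M x.
  apply: component_refl => -[[n _ kx]|[_ [n _ <-]]].
    by have [[]] := kP n; rewrite kx; case: (stC n).
  by have [] := kP n.
have cM : connected M := @component_connected _ _ _.
have AM : A `&` M = set0 by apply/seteqP; split=> // z [Az /component_sub]; apply; left.
have NAM : nb A `&` M = set0.
  by apply/seteqP; split=> // z [Az /component_sub]; apply; right.
have finM := separator_finite chG noH cA cM AM NAM.
have [||n nP] := @finite_bound _ _ (fun n s => exists2 j, j < n & adj s (k j)) finM.
- by move=> m n s mn [j jm sj]; exists j => //; exact: leq_trans jm mn.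
- by move=> s [[_ [j _ <-]] sj] _; exists j.+1, j.
have CM : C n `<=` M.
  apply: connected_trap Mx _; [by case: (stC n)|by case: (stC n)|].
  move=> z Cz zM; apply: component_nb => // -[Az|Az].
    case: zM => y My zy; rewrite -[False]/(set0 y) -NAM; split=> //.
    by exists z => //; apply: adj_sym.
  (* Here [z] would be in the finite boundary of [M], hence adjacent to some [k j] with [j < n]; but
     [C n] lies in [C j.+1], which has no neighbour of [k j]. *)
  have [|j jn zj] := nP z; first by split.
  have Cj : C j.+1 z by apply: (Cdec j.+1 (n - j.+1)); rewrite subnKC.
  by have [_ _ e] := kP j; rewrite e in Cj; case: (away_nadj Cj).
have [[_ [y Cy ky]] _ _] := kP n.
rewrite -[False]/(set0 y) -NAM; split; last exact: CM.
by exists (k n); [exists n|apply: adj_sym].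
Qed.

Lemma below_Acc x C : stage x C -> Acc (below x) C.
Proof.
move=> sC; apply: contrapT => nC.
pose bad C := stage x C /\ ~ Acc (below x) C.
have step D : exists E, bad D -> bad E /\ below x E D.
  have [[sD nD]|nD] := pselect (bad D); last by exists set0.
  suff [E [ED nE]] : exists E, below x E D /\ ~ Acc (below x) E.
    by exists E => _; split=> //; split=> //; exact: below_stage ED.
  apply: contrapT => /forallNP H; apply: nD; constructor => E ED.
  by apply: contrapT => nE; apply: (H E).
have [F FP] := choice step; pose D n := iter n F C.
have badD n : bad (D n) by elim: n => //= n /FP[].
have exk n : exists k, [/\ bd (D n) k, ~ adj x k & D n.+1 = away x k (D n)].
  by have [_] := FP _ (badD n).
have [k kP] := choice exk.
by apply: (@no_descent x D k) => // n; case: (badD n).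
Qed.

Definition explored C l := elimination_seq (~` C) l /\ clique_attached (~` C `|` seqset l).

(** If [l] and [bd C] together form a clique, any order of [l] works and whatever remains attaches
    to a subset of this clique. *)
Lemma explored_clique C l : connected C -> clique_attached (~` C) -> seqset l `<=` C ->
  clique (seqset l `|` bd C) -> explored C l.
Proof.
move=> cC gC lC kC; split.
  move=> v vl; apply: clique_sub kC => u [uv []]; last by move=> [ul _]; left.
  by move=> Cu; right; split=> //; exists v => //; apply: lC.
move=> D cD CD; have DC : D `<=` C.
  by move=> z Dz; apply: contrapT => Cz; rewrite -[False]/(set0 z) -CD; split=> //; left.
have sub : (~` C `|` seqset l) `&` nb D `<=` seqset l `|` bd C.
  by move=> z [[Cz|lz] Dz]; [right; split=> //; apply: nb_sub Dz|left].
split; last exact: clique_sub sub kC.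
apply: sub_finite_set sub _; rewrite finite_setU.
split; last exact: (clique_attached_bd gC cC).1.
by apply/(@finite_seqP {classic G}); exists l.
Qed.

(** As [l1] covers the boundary of [D] inside [C], a connected set avoiding both lists lies in [D],
    where [l2] decides, or misses [D], where [l1] decides. *)
Lemma explored_cat C D l1 l2 : explored C l1 -> seqset l1 `<=` C `\` D -> D `<=` C ->
  C `&` bd D `<=` seqset l1 -> explored D l2 -> seqset l2 `<=` D ->
  explored C (l1 ++ l2).
Proof.
move=> [e1 g1] l1C DC NDl1 [e2 g2] l2D.
have dis v : v \in l2 -> v \notin l1.
  by move=> /l2D Dv; apply/negP => /l1C[_].
split.
  move=> v; rewrite mem_cat => /orP[vl1|vl2].
    apply: clique_sub (e1 v vl1) => u [uv [Cu|[ul lt]]]; split=> //; first by left.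
    move: lt; rewrite !index_cat vl1; case: ifP => [ul1|_]; first by right.
    by have := index_mem v l1; rewrite vl1; lia.
  apply: clique_sub (e2 v vl2) => u [uv [Cu|[ul lt]]]; split=> //.
    by left=> /DC.
  move: lt; rewrite !index_cat (negPf (dis _ vl2)); case: ifP => [ul1 _|ul1].
    by left; case: (l1C _ ul1).
  by rewrite ltn_add2l => lt; right; split=> //; move: ul; rewrite mem_cat ul1.
move=> E cE CE.
have avoid z : E z -> C z /\ ~ seqset (l1 ++ l2) z.
  move=> Ez; split; first apply: contrapT; move=> H;
    rewrite -[False]/(set0 z) -CE; split=> //.
    by left.
  by right.
have nl1 z : E z -> ~ seqset l1 z.
  by move=> /avoid[_ H] zl; apply: H; rewrite /seqset /= mem_cat; apply/orP; left.
have nl2 z : E z -> ~ seqset l2 z.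
  by move=> /avoid[_ H] zl; apply: H; rewrite /seqset /= mem_cat; apply/orP; right.
have [[y [Ey Dy]]|ED] := pselect (exists y, E y /\ D y).
  have subE : E `<=` D.
    apply: connected_trap Ey Dy _ => // z Ez zD; apply: contrapT => Dz.
    by apply: (nl1 z Ez); apply: NDl1; split; [case: (avoid z Ez)|].
  have [|f c] := g2 E cE.
    by apply/seteqP; split=> // z [[Dz|lz] Ez]; [apply/Dz/subE|apply: nl2 lz].
  suff sub : (~` C `|` seqset (l1 ++ l2)) `&` nb E `<=` (~` D `|` seqset l2) `&` nb E.
    by split; [apply: sub_finite_set f|apply: clique_sub c].
  move=> z [zl zE]; split=> //; case: zl => [Cz|]; first by left=> /DC.
  rewrite /seqset /= mem_cat => /orP[/l1C[_ Dz]|]; by [left|right].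
have [|f c] := g1 E cE.
  by apply/seteqP; split=> // z [[Cz|lz] Ez]; [apply: Cz; case: (avoid z Ez)|apply: nl1 lz].
suff sub : (~` C `|` seqset (l1 ++ l2)) `&` nb E `<=` (~` C `|` seqset l1) `&` nb E.
  by split; [apply: sub_finite_set f|apply: clique_sub c].
move=> z [zl zE]; split=> //; case: zl => [Cz|]; first by left.
rewrite /seqset /= mem_cat => /orP[|/l2D Dz]; first by right.
right; case: zE => y Ey zy; case: ED; exists y; split=> //.
apply: contrapT => Dy; apply: (nl1 y Ey); apply: NDl1; split; first by case: (avoid y Ey).
by split=> //; exists z => //; apply: adj_sym.
Qed.

(* The inner induction is on the vertices [k] of [bd C] that are not complete to
   [C & bd W]: for such a [k], replacing [W] by its component [D] of [C - bd(k)]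
   makes [k] complete and spoils no other vertex. The outer induction then treats
   [W] inside [D]. *)
Lemma explore_around x C W : stage x C -> stage x W -> W `<=` C ->
  exists l, [/\ explored C l, seqset l `<=` C `\` W & C `&` bd W `<=` seqset l].
Proof.
move=> sC; have acc := below_Acc sC; elim: acc W sC => {}C _ IHout W sC.
have [cC Cx gC] := sC; have [finC clC] := clique_attached_bd gC cC.
pose bad W k := bd C k /\ ~ forall z, C z -> bd W z -> adj k z.
have [L LP] : exists L : seq {classic G}, bd C = [set` L].
  exact/(@finite_seqP {classic G}).
(* The length of a list containing all bad vertices is the measure of the inner induction. *)
have : forall k : G, bad W k -> (k : {classic G}) \in L.
  by move=> k [Nk _]; have : bd C k := Nk; rewrite LP.
have [n] := ubnP (size L); elim: n L W {LP} => // n IHin L W sL LP sW WC.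
have [cW Wx gW] := sW; have [finW clW] := clique_attached_bd gW cW.
have [[k [Nk /existsNP[z0 /not_implyP[Cz0 /not_implyP[Nz0 kz0]]]]]|nobad] :=
    pselect (exists k, bad W k); last first.
  have [l lP] : exists l : seq {classic G}, C `&` bd W = [set` l].
    apply/(@finite_seqP {classic G}); apply: sub_finite_set finW.
    by move=> z [].
  have lE : seqset l = C `&` bd W by rewrite lP.
  exists l; rewrite lE; split=> //; last by move=> z [Cz [Wz _]].
  apply: explored_clique => //; rewrite lE; first by move=> z [].
  have compl k z : bd C k -> (C `&` bd W) z -> adj k z.
    move=> Nk [Cz Nz]; apply: contrapT => kz; apply: nobad; exists k; split=> // H.
    exact: kz (H z Cz Nz).
  move=> u v [uW|uC] [vW|vC] uv.
  - by apply: clW uv; [case: uW|case: vW].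
  - by apply/adj_sym/compl.
  - exact: compl.
  - exact: clC.
(* Otherwise [k] and [z0] would both be in the clique [bd W]. *)
have kW : ~ nb W k.
  move=> kW; apply: kz0; apply: clW => //.
    by split=> // /WC; case: Nk.
  by move=> e; rewrite -e in Cz0; case: Nk.
have xk : ~ adj x k by move=> xk; apply: kW; exists x => //; apply: adj_sym.
have sD := away_stage sC Nk xk; set D := away x k C in sD *.
have [cD Dx gD] := sD; have [_ clD] := clique_attached_bd gD cD.
have DC : D `<=` C := @away_sub x k C.
have WD : W `<=` D.
  apply: component_max => // z Wz; split; first exact: WC.
  by move=> /nb1 zk; apply: kW; exists z => //; apply: adj_sym.
have Dz0 : D z0.
  apply: component_nb; first by split=> // /nb1 /adj_sym.
  by apply: nb_sub WD _ _; case: Nz0.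
have kL : (k : {classic G}) \in L by apply: LP; split=> // H; apply: kz0; apply: H.
have [l1 [ex1 l1C cov1]] : exists l, [/\ explored C l, seqset l `<=` C `\` D &
    C `&` bd D `<=` seqset l].
  apply: (IHin (rem (k : {classic G}) L)) => //.
    by rewrite size_rem //; case: (L) kL sL => //= ? ? _; lia.
  (* A vertex [k'] bad for [D] is bad for [W]: otherwise it would be adjacent to [z0] in [D], hence
     lie in the clique [bd D] and be complete to the rest of it. *)
  move=> k' [Nk' bad']; have kk' : k' <> k.
    move=> e; apply: bad' => z Cz Nz; rewrite e; apply: adj_sym.
    exact: away_bd Nz.
  have : (k' : {classic G}) \in L.
    apply: LP; split=> // H; apply: bad' => z Cz Nz; apply: clD => //.
      split; first by move=> /DC; case: Nk'.
      by exists z0 => //; apply: H.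
    by move=> e; rewrite -e in Cz; case: Nk'.
  by rewrite (perm_mem (perm_to_rem kL)) in_cons => /orP[/eqP|].
have [|l2 [ex2 l2D cov2]] := IHout D _ W sD sW WD; first by exists k.
exists (l1 ++ l2); split.
- apply: explored_cat ex1 l1C DC cov1 ex2 _.
  by move=> z /l2D[].
- move=> z; rewrite /seqset /= mem_cat => /orP[/l1C[Cz Dz]|/l2D[Dz Wz]].
    by split=> // /WD.
  by split=> //; apply: DC.
move=> z [Cz Nz]; rewrite /seqset /= mem_cat; apply/orP.
have [Dz|Dz] := pselect (D z); first by right; apply: cov2.
by left; apply: cov1; split=> //; split=> //; apply: nb_sub WD _ _; case: Nz.
Qed.

(** If [x] is complete to [bd C], it can be taken at once. Otherwise some [k] in [bd C] is not
    adjacent to [x]; the boundary of [away x k C] is explored first, then the recursion continues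
    inside. *)
Lemma explore_to x C : stage x C ->
  exists l, [/\ explored C l, seqset l `<=` C & (x : {classic G}) \in l].
Proof.
move=> sC; have acc := below_Acc sC; elim: acc sC => {}C _ IH sC.
have [cC Cx gC] := sC; have [finC clC] := clique_attached_bd gC cC.
have [[k [Nk xk]]|compl] := pselect (exists k, bd C k /\ ~ adj x k); last first.
  have lE : seqset [:: (x : {classic G})] = [set x].
    by apply/seteqP; split=> z; [rewrite /seqset /= inE => /eqP|move=> ->; exact: mem_head].
  exists [:: (x : {classic G})]; rewrite lE mem_head; split=> //; last by move=> _ ->.
  apply: explored_clique; rewrite ?lE //; first by move=> _ ->.
  have xC v : bd C v -> adj x v by move=> Nv; apply: contrapT => xv; apply: compl; exists v.
  move=> u v [->|uC] [->|vC] uv //; [exact: xC|exact/adj_sym/xC|exact: clC].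
have sD := away_stage sC Nk xk.
have [l1 [ex1 l1C cov1]] := explore_around sC sD (@away_sub x k C).
have [|//|l2 [ex2 l2D xl2]] := IH (away x k C); first by exists k.
exists (l1 ++ l2); split.
- exact: explored_cat ex1 l1C (@away_sub x k C) cov1 ex2 l2D.
- move=> z; rewrite /seqset /= mem_cat => /orP[/l1C[]//|/l2D].
  exact: away_sub.
- by rewrite mem_cat xl2 orbT.
Qed.

End Exploration.

(** * Exhausting the graph *)

Section Layers.
Variables (G : graph) (F : set G -> seq {classic G}).

Fixpoint layer n : set G :=
  if n is m.+1 then
    layer m `|` [set v | ~ layer m v /\ seqset (F (component (~` layer m) v)) v]
  else set0.

Definition piece n v : set G := component (~` layer n) v.

Lemma layer_mono m n : m <= n -> layer m `<=` layer n.
Proof. by move=> /subnK <-; elim: (n - m) => // k IH v /IH; left. Qed.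

Lemma piece_refl n v : ~ layer n v -> piece n v v.
Proof. exact: component_refl. Qed.

Lemma piece_avoid n v u : piece n v u -> ~ layer n u.
Proof. exact: component_sub. Qed.

Lemma piece_mono m n v : m <= n -> piece n v `<=` piece m v.
Proof. by move=> mn u; apply: conn_sub => z nz /(layer_mono mn). Qed.

Lemma piece_bd n v : bd (piece n v) `<=` layer n `&` nb (piece n v).
Proof.
move=> z [vz zv]; split=> //; apply: contrapT => nz; apply: vz.
exact: component_nb.
Qed.

Lemma piece_good n v : clique_attached (layer n) -> clique_attached (~` piece n v).
Proof.
move=> gn; have [|f c] := gn (piece n v) (@component_connected _ _ _).
  by apply/seteqP; split=> // z [nz /piece_avoid].
by apply: clique_attached_compl; [apply: sub_finite_set f|apply: clique_sub c]; apply: piece_bd.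
Qed.

Hypothesis F_explored : forall C, connected C -> C !=set0 -> clique_attached (~` C) ->
  explored C (F C) /\ seqset (F C) `<=` C.

(** A connected set avoiding [layer n.+1] lies in a single piece [C] of round [n], and within [C]
    the new layer is exactly [F C]. *)
Lemma layer_good n : clique_attached (layer n).
Proof.
elim: n => [|n IH] D cD LD.
  by rewrite set0I; split; [exact: finite_set0|move=> ? ? []].
have [D0|D0] := pselect (D = set0).
  suff -> : layer n.+1 `&` nb D = set0 by split; [exact: finite_set0|move=> ? ? []].
  by rewrite D0; apply/seteqP; split=> // z [_ [? []]].
have /set0P[v Dv] : D != set0 by apply/eqP.
have avoid z : D z -> ~ layer n.+1 z by move=> Dz lz; rewrite -[False]/(set0 z) -LD.
have nv : ~ layer n v by move=> lv; apply: (avoid v Dv); left.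
have gC := @piece_good n v IH; set C := piece n v in gC.
have Cv : C v := piece_refl nv.
have DC : D `<=` C by apply: component_max => // z Dz lz; apply: (avoid z Dz); left.
have CE z : C z -> component (~` layer n) z = C := @component_eq _ _ _ _.
have [|[_ gF] FC] := F_explored (@component_connected _ (~` layer n) v) _ gC.
  by exists v.
have [|f c] := gF D cD.
  apply/seteqP; split=> // z [[Cz|Fz] Dz]; first exact/Cz/DC.
  apply: (avoid z Dz); right.
  by split; [exact: piece_avoid (DC _ Dz)|rewrite CE //; exact: DC].
suff sub : layer n.+1 `&` nb D `<=` (~` C `|` seqset (F C)) `&` nb D.
  by split; [apply: sub_finite_set f|apply: clique_sub c].
move=> z [lz Dz]; split=> //; have [Cz|Cz] := pselect (C z); last by left.
right; case: lz => [/(piece_avoid Cz)//|[_]].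
by rewrite CE.
Qed.

Lemma piece_explored n v : ~ layer n v ->
  explored (piece n v) (F (piece n v)) /\ seqset (F (piece n v)) `<=` piece n v.
Proof.
move=> nv; apply: F_explored; first exact: component_connected.
  by exists v; apply: piece_refl.
exact/piece_good/layer_good.
Qed.

Lemma layers_elimination : (forall v, exists n, layer n v) ->
  exists h : G -> nat, elimination h.
Proof.
move=> cover.
(* The round of [v] is the last [n] with [v] outside [layer n], so that [piece n v] still contains
   [v]. *)
have ex v : exists n, ~ layer n v /\ layer n.+1 v.
  have [n] := cover v; elim: n => // n IH nv.
  by have [/IH//|nv'] := pselect (layer n v); exists n.
have [r1 r1P] := choice ex.
pose C v := piece (r1 v) v; pose r2 v := index (v : {classic G}) (F (C v)).
have Cv v : C v v by apply: piece_refl; case: (r1P v).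
have Fv v : (v : {classic G}) \in F (C v).
  by have [nv [lv|[_ Fv]]] := r1P v; first by case: nv.
have Cadj x y : adj x y -> r1 x = r1 y -> C y = C x.
  move=> xy e; rewrite /C -e; apply: component_eq; apply: component_nb.
    by rewrite e; case: (r1P y).
  by exists x; [exact: Cv|exact: adj_sym].
apply: (@elimination_of_rank _ r1 r2).
  move=> x y xy e1 e2; apply: (adj_neq xy).
  have := Cadj _ _ xy e1 => CE; move: e2; rewrite /r2 CE.
  move=> /(congr1 (nth (x : {classic G}) (F (C x)))); rewrite !nth_index //.
  by rewrite -CE.
move=> x; have [[eF gF] FC] : explored (C x) (F (C x)) /\ seqset (F (C x)) `<=` C x.
  by apply: piece_explored; case: (r1P x).
have sub : lex_lower r1 r2 x `<=` [set u : G | adj u x /\ (~ C x u \/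
    ((u : {classic G}) \in F (C x) /\ index (u : {classic G}) (F (C x)) < r2 x))].
  move=> u [xu ux]; split; first exact: adj_sym.
  case: ux => [lt|[e lt]].
    by left=> /piece_avoid; apply; apply: (layer_mono lt); case: (r1P u).
  by right; move: lt; rewrite {1}/r2 -(Cadj _ _ xu (esym e)).
split; last exact: clique_sub sub (eF _ (Fv x)).
apply: (@sub_finite_set _ _ (bd (C x) `|` seqset (F (C x)))).
  move=> u /sub[ux [Cu|[Fu _]]]; last by right.
  by left; split=> //; exists x.
rewrite finite_setU; split; last by apply/(@finite_seqP {classic G}); exists (F (C x)).
apply: (clique_attached_bd _ _).1; last exact: component_connected.
exact/piece_good/layer_good.
Qed.

End Layers.

Lemma chordal_nst_elimination (G : graph) : chordal G -> has_normal_spanning_tree G ->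
  ~ induced_minor calH G -> exists h : G -> nat, elimination h.
Proof.
move=> chG /nst_rank[h hP] noH.
have ex (C : set G) : exists l : seq {classic G},
    connected C -> C !=set0 -> clique_attached (~` C) ->
    [/\ explored C l, seqset l `<=` C & exists2 m, seqset l m &
      forall v, C v -> v <> m -> h m < h v].
  have [[cC C0 gC]|nC] :=
      pselect [/\ connected C, C !=set0 & clique_attached (~` C)]; last first.
    by exists [::] => cC C0 gC; case: nC.
  have [m Cm mmin] := hP C cC C0.
  have [|l [eC lC ml]] := @explore_to G chG noH m C; first by [].
  by exists l; split=> //; exists m.
have [F FP] := choice ex.
have FE C : connected C -> C !=set0 -> clique_attached (~` C) ->
    explored C (F C) /\ seqset (F C) `<=` C.
  by move=> cC C0 gC; have [] := FP C cC C0 gC.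
apply: (@layers_elimination G F FE) => v.
apply: contrapT => /forallNP nv.
have least n : exists2 m, seqset (F (piece F n v)) m &
    forall u, piece F n v u -> u <> m -> h m < h u.
  have [||//] := FP (piece F n v) (@component_connected _ _ _).
  - by exists v; apply: piece_refl.
  - exact/piece_good/layer_good.
have FC n : seqset (F (piece F n v)) `<=` piece F n v.
  by have [] := piece_explored FE (nv n).
have grow n : exists m, [/\ seqset (F (piece F n v)) m, n <= h m &
    forall u, piece F n v u -> u <> m -> h m < h u].
  (* The least vertex of a piece enters the next layer, so the least vertex of the next piece is a
     different vertex of the old one and has larger height. For [n] above [h v] this contradicts
     that [v] is in the piece. *)
  elim: n => [|n [m [Fm nm mmin]]].
    by have [m Fm mmin] := least 0; exists m.
  have [m' Fm' mmin'] := least n.+1; exists m'; split=> //.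
  have pm' := FC _ _ Fm'; apply: leq_ltn_trans nm (mmin _ (piece_mono _ pm') _) => //.
  move=> e; apply: (piece_avoid pm'); rewrite e; right.
  have pm := FC _ _ Fm; split; first exact: piece_avoid pm.
  by rewrite (component_eq pm).
have [m [_ hm mmin]] := grow (h v).+1.
have vm : v <> m by move=> e; rewrite -e ltnn in hm.
by have := mmin v (piece_refl (nv _)) vm; rewrite ltnNge ltnW.
Qed.

Theorem theorem1p3 (G : graph) (hG : connected_graph G) :
  has_tree_decomposition_into_finite_cliques G <->
  chordal G /\ has_normal_spanning_tree G /\ ~ induced_minor calH G.
Proof.
split.
  move=> /tree_decomposition_elimination[h hE].
  split; first exact: elimination_chordal hE.
  by split; [exact: elimination_nst hG hE|exact: elimination_no_calH hE].
move=> [chG [nst noH]]; have [h hE] := chordal_nst_elimination chG nst noH.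
exact: elimination_tree_decomposition hG hE.
Qed.
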